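(* Let $S'$ be the saturated multiplicative subset of $\mathbb{Z}[\mathbb{L}]$ generated by the elements $\mathbb{L}^n-1$, for $n>0$. Then the classes $[Y_G]$ of the affine graph hypersurface complements, as $G$ ranges over all finite graphs, do not generate ${S'}^{-1}K(\mathrm{Var})$ as a module over ${S'}^{-1}\mathbb{Z}[\mathbb{L}]$.
   Context: Graphs are finite; looping edges and multiple edges are allowed, and graphs need not be connected. For a connected graph $G$ with edges $e_1,\dots,e_n$ and corresponding variables $t_1,\dots,t_n$, the graph polynomial is $\psi_G(t_1,\dots,t_n)=\sum_{T\subseteq G}\prod_{e\notin T}t_e$, where $T$ runs over the spanning trees of $G$ and $t_e$ is the variable of the edge $e$. For a general finite graph, $\psi_G$ is the product of the graph polynomials of its connected components. Let $\widehat X_G\subset\mathbb{A}^n$ be the affine hypersurface $\{\psi_G=0\}$ and $Y_G=\mathbb{A}^n\smallsetminus\widehat X_G$ the affine graph hypersurface complement. $K(\mathrm{Var})$ is the Grothendieck ring of varieties over $\mathbb{Q}$: it is generated by isomorphism classes of quasi-projective varieties, with relations $[X]=[X\smallsetminus Y]+[Y]$ for closed embeddings $Y\subseteq X$ and product $[X]\cdot[Y]=[X\times Y]$. It is regarded as a module over $\mathbb{Z}[\mathbb{L}]$ via multiplication by $\mathbb{L}=[\mathbb{A}^1]$. A multiplicative subset is saturated if it contains every divisor of each of its elements. *)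

(* Defs.v *)
From HB Require Import structures.
From mathcomp Require Import all_boot all_order all_algebra all_field.
From mathcomp Require Import generic_quotient ring_quotient.
From mathcomp Require Import ring.
From mathcomp Require Import boolp.
From mathcomp.multinomials Require monalg.
Import -(notations) monalg.
From mathcomp Require Import mpoly.

Set Implicit Arguments.
Unset Strict Implicit.
Unset Printing Implicit Defensive.

Import GRing.Theory.
Local Open Scope ring_scope.
Local Open Scope quotient_scope.

(** * Graphs and graph polynomials *)

(* Loops and multiple edges are allowed; the orientation of the pair [ends e]
   is never used. *)
Record graph := Graph {
  vertex : finType;
  nedges : nat;
  ends : 'I_nedges -> vertex * vertex
}.

Section GraphPolynomial.
Variable G : graph.
Local Notation V := (vertex G).
Local Notation n := (nedges G).
Implicit Types (T : {set 'I_n}) (C : {set V}).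

Definition joins (e : 'I_n) (u v : V) : bool :=
  (ends e == (u, v)) || (ends e == (v, u)).

Definition adj T (u v : V) : bool := [exists e in T, joins e u v].

(* [(v_1, e_1); ...; (v_k, e_k)] with k > 0, distinct vertices, distinct edges,
   and e_i joining v_i to v_(i+1), indices modulo k. *)
Definition is_cycle (c : seq (V * 'I_n)) : bool :=
  [&& 0 < size c, uniq (map fst c), uniq (map snd c)
    & cycle (fun a b => joins a.2 a.1 b.1) c]%N.

Definition acyclic T : Prop :=
  forall c, is_cycle c -> ~ {subset map snd c <= T}.

Definition components : {set {set V}} :=
  [set [set w | connect (adj setT) v w] | v in V].

Definition edges_of C : {set 'I_n} := [set e | (ends e).1 \in C].

Definition spanning_tree C T : Prop :=
  [/\ T \subset edges_of C,
      {in C &, forall u v, connect (adj T) u v}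
    & acyclic T].

Definition component_polynomial C : {mpoly rat[n]} :=
  \sum_(T : {set 'I_n} | `[< spanning_tree C T >])
    \prod_(e in edges_of C :\: T) 'X_e.

Definition graph_polynomial : {mpoly rat[n]} :=
  \prod_(C in components) component_polynomial C.

End GraphPolynomial.

(** * Quasi-projective varieties over Q *)

Definition hpoly (N : nat) := {p : {mpoly rat[N]} | p \is homog mdeg}.

(* A locally closed subset of P^(N-1), N being the number of homogeneous
   coordinates: the locus where all the polynomials of the first list vanish
   and at least one of the second does not.  A variety over Q (a reduced
   quasi-projective Q-scheme, not necessarily irreducible) is identified with
   its set of points over algC, the algebraic closure of Q, together with the
   Q-structure given by rational equations. *)
Definition locally_closed (N : nat) := (seq (hpoly N) * seq (hpoly N))%type.

Definition variety := {N : nat & locally_closed N}.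

Definition peval N (p : {mpoly rat[N]}) (x : 'rV[algC]_N) : algC :=
  (map_mpoly ratr p).@[x 0].

Definition proj_eq N (x y : 'rV[algC]_N) : Prop :=
  exists2 c : algC, c != 0 & y = c *: x.

(* Points are handled through their (nonzero) vectors of homogeneous
   coordinates. *)
Definition in_locus N (X : locally_closed N) (x : 'rV[algC]_N) : Prop :=
  [/\ x != 0,
      forall p, p \in X.1 -> peval (val p) x = 0
    & exists2 q, q \in X.2 & peval (val q) x != 0].

(* Near each point, a regular map is given by homogeneous polynomials of the
   same degree with rational coefficients; the neighbourhood may be taken to be
   the whole open subset of X where these do not vanish simultaneously, since
   they may be multiplied by a form vanishing outside a smaller one. *)
Definition regular_map N M (X : locally_closed N) (Y : locally_closed M)
    (f : 'rV[algC]_N -> 'rV[algC]_M) : Prop :=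
  forall x, in_locus X x ->
    in_locus Y (f x) /\
    exists (d : nat) (P : 'I_M -> {mpoly rat[N]}),
      [/\ forall i, P i \is d.-homog,
          \row_i peval (P i) x != 0
        & forall y, in_locus X y -> \row_i peval (P i) y != 0 ->
            proj_eq (f y) (\row_i peval (P i) y)].

Definition isomorphic N M (X : locally_closed N) (Y : locally_closed M) : Prop :=
  exists f g,
    [/\ regular_map X Y f, regular_map Y X g,
        forall x, in_locus X x -> proj_eq (g (f x)) x
      & forall y, in_locus Y y -> proj_eq (f (g y)) y].

Definition closed_in N (Y X : locally_closed N) : Prop :=
  exists s : seq (hpoly N), forall x,
    in_locus Y x <-> in_locus X x /\ forall p, p \in s -> peval (val p) x = 0.

Definition is_difference N (U X Y : locally_closed N) : Prop :=
  forall x, in_locus U x <-> in_locus X x /\ ~ in_locus Y x.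

(* The image of X * Y under the Segre embedding
   ([x_i], [y_j]) |-> [x_i y_j]. *)
Definition is_product N M (Z : locally_closed (N * M))
    (X : locally_closed N) (Y : locally_closed M) : Prop :=
  forall z, in_locus Z z <->
    exists x y, [/\ in_locus X x, in_locus Y y & z = mxvec (x^T *m y)].

(** * Affine spaces and hypersurface complements *)

Lemma dhomogXn n (i : 'I_n) k : ('X_i ^+ k : {mpoly rat[n]}) \is k.-homog.
Proof.
have := @dhomogMn n rat mdeg 1 'X_i k; rewrite mul1n; apply.
by rewrite dhomogX /= mdeg1.
Qed.

Lemma homogX0 n : ('X_ord0 : {mpoly rat[n.+1]}) \is homog mdeg.
Proof. by apply/homogP; exists 1%N; apply: (dhomogXn ord0 1). Qed.

Definition homogenize n (p : {mpoly rat[n]}) : {mpoly rat[n.+1]} :=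
  \sum_(m <- msupp p)
    p@_m *: ('X_ord0 ^+ ((msize p).-1 - mdeg m)
             * \prod_(i < n) 'X_(lift ord0 i) ^+ m i).

Lemma homogenize_homog n (p : {mpoly rat[n]}) :
  'X_ord0 * homogenize p \is homog mdeg.
Proof.
apply/homogP; exists (1 + (msize p).-1)%N.
apply: dhomogM; first exact: (dhomogXn ord0 1).
rewrite /homogenize big_seq; apply: rpred_sum => m mp; apply: rpredZ.
have le_m : (mdeg m <= (msize p).-1)%N.
  by have := msize_mdeg_lt mp; case: (msize p).
have := @dhomogM n.+1 rat mdeg ((msize p).-1 - mdeg m)%N
          ('X_ord0 ^+ ((msize p).-1 - mdeg m)) (mdeg m).
rewrite /= subnK //; apply; first exact: dhomogXn.
rewrite mdegE; elim/big_ind2: _ => [|d q e r dq er|i _]; first exact: dhomog1.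
  exact: dhomogM.
exact: dhomogXn.
Qed.

(* A^n is the open subset x_0 <> 0 of P^n. *)
Definition affine_space (n : nat) : variety :=
  existT locally_closed n.+1 ([::], [:: exist _ 'X_ord0 (homogX0 n)]).

(* The complement in A^n of the hypersurface p = 0. *)
Definition affine_complement n (p : {mpoly rat[n]}) : variety :=
  existT locally_closed n.+1
    ([::], [:: exist _ ('X_ord0 * homogenize p) (homogenize_homog p)]).

Definition graph_complement (G : graph) : variety :=
  affine_complement (graph_polynomial G).

(** * Commutative rings given by generators and relations *)

Section QuotientRing.
Variables (R : comNzRingType) (rel : R -> Prop).

Inductive ideal_gen : R -> Prop :=
| ideal_gen0 : ideal_gen 0
| ideal_genD a r x : rel r -> ideal_gen x -> ideal_gen (a * r + x).

Definition ideal_pred : {pred R} := [pred x | `[< ideal_gen x >]].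

Lemma ideal_genDD x y : ideal_gen x -> ideal_gen y -> ideal_gen (x + y).
Proof.
elim=> [|a r z hr _ IH] hy; rewrite ?add0r // -addrA.
by apply: ideal_genD => //; apply: IH.
Qed.

Lemma ideal_genM a x : ideal_gen x -> ideal_gen (a * x).
Proof.
elim=> [|b r z hr _ IH]; rewrite ?mulr0; first exact: ideal_gen0.
by rewrite mulrDr mulrA; apply: ideal_genD.
Qed.

Lemma ideal_pred_closed : zmod_closed ideal_pred.
Proof.
split=> [|x y /asboolP hx /asboolP hy]; first exact/asboolP/ideal_gen0.
apply/asboolP/ideal_genDD => //.
by rewrite -mulN1r; apply: ideal_genM.
Qed.
HB.instance Definition _ := GRing.isZmodClosed.Build R ideal_pred ideal_pred_closed.

(* [{ideal_quot _}] of the library wants a proof that the ideal is proper. *)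
Definition quotient_ring := Quotient.quot ideal_pred.
HB.instance Definition _ := GRing.Zmodule.on quotient_ring.

Definition quotient_class : R -> quotient_ring := \pi_(Quotient.quot ideal_pred).

Lemma quotient_classP x y :
  reflect (ideal_gen (x - y)) (quotient_class x == quotient_class y).
Proof. by rewrite /quotient_class -Quotient.idealrBE; apply: asboolP. Qed.

Lemma quotient_classW (P : quotient_ring -> Prop) :
  (forall x, P (quotient_class x)) -> forall x, P x.
Proof. by move=> h; apply: quotW. Qed.

Lemma quotient_classD : {morph quotient_class : x y / x + y}.
Proof. by move=> x y; rewrite /quotient_class !piE. Qed.

Definition quotient_mul (x y : quotient_ring) : quotient_ring :=
  quotient_class (repr x * repr y).

Lemma quotient_classM x y :
  quotient_class (x * y) = quotient_mul (quotient_class x) (quotient_class y).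
Proof.
have reprP z : ideal_gen (z - repr (quotient_class z)).
  by apply/quotient_classP; rewrite /quotient_class reprK.
apply/eqP/quotient_classP.
set x' := repr _; set y' := repr _.
have -> : x * y - x' * y' = y * (x - x') + x' * (y - y').
  by rewrite !mulrBr (mulrC y x) (mulrC y x') addrA subrK.
by apply: ideal_genDD; apply: ideal_genM; apply: reprP.
Qed.

Fact quotient_mulA : associative quotient_mul.
Proof.
do 3![elim/quotient_classW=> ?].
by rewrite -!quotient_classM mulrA.
Qed.
Fact quotient_mulC : commutative quotient_mul.
Proof. by do 2![elim/quotient_classW=> ?]; rewrite -!quotient_classM mulrC. Qed.
Fact quotient_mul1 : left_id (quotient_class 1) quotient_mul.
Proof. by elim/quotient_classW=> ?; rewrite -!quotient_classM mul1r. Qed.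
Fact quotient_mulDl : left_distributive quotient_mul +%R.
Proof.
do 3![elim/quotient_classW=> ?].
by rewrite -quotient_classD -!quotient_classM mulrDl quotient_classD.
Qed.
HB.instance Definition _ := GRing.Zmodule_isComPzRing.Build quotient_ring
  quotient_mulA quotient_mulC quotient_mul1 quotient_mulDl.

Fact quotient_class_zmod : zmod_morphism quotient_class.
Proof. by move=> x y; rewrite /quotient_class !piE. Qed.
Fact quotient_class_monoid : monoid_morphism quotient_class.
Proof. by split=> // x y; apply: quotient_classM. Qed.
HB.instance Definition _ :=
  GRing.isZmodMorphism.Build R quotient_ring quotient_class quotient_class_zmod.
HB.instance Definition _ :=
  GRing.isMonoidMorphism.Build R quotient_ring quotient_class quotient_class_monoid.

End QuotientRing.

(** * The Grothendieck ring of varieties *)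

(* The free commutative ring on the symbols <X>, for X a variety. *)
Definition free_ring : comNzRingType := monalg.malg (monalg.cmonom variety) int.

Definition symbol (X : variety) : free_ring := monalg.mkmalgU (monalg.ucm X) 1.

Definition symbol_in N (X : locally_closed N) : free_ring :=
  symbol (existT locally_closed N X).

Inductive K_relation : free_ring -> Prop :=
| K_iso N M (X : locally_closed N) (Y : locally_closed M) :
    isomorphic X Y -> K_relation (symbol_in X - symbol_in Y)
| K_scissor N (X Y U : locally_closed N) :
    closed_in Y X -> is_difference U X Y ->
    K_relation (symbol_in X - (symbol_in U + symbol_in Y))
| K_product N M (X : locally_closed N) (Y : locally_closed M)
      (Z : locally_closed (N * M)) :
    is_product Z X Y ->
    K_relation (symbol_in X * symbol_in Y - symbol_in Z)
| K_point : K_relation (symbol (affine_space 0) - 1).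

Definition KVar := quotient_ring K_relation.
HB.instance Definition _ := GRing.ComPzRing.on KVar.

Definition K_class (X : variety) : KVar := quotient_class K_relation (symbol X).

(* The action of Z[L] = {poly int}, the indeterminate acting as [A^1]. *)
Definition Z_L_to_KVar (p : {poly int}) : KVar :=
  quotient_class K_relation (map_poly intr p).[symbol (affine_space 1)].

Fact Z_L_to_KVar_zmod : zmod_morphism Z_L_to_KVar.
Proof. by move=> p q; rewrite /Z_L_to_KVar !rmorphB hornerD hornerN rmorphB. Qed.
Fact Z_L_to_KVar_monoid : monoid_morphism Z_L_to_KVar.
Proof.
split=> [|p q]; rewrite /Z_L_to_KVar; first by rewrite rmorph1 hornerC rmorph1.
by rewrite rmorphM hornerM rmorphM.
Qed.
HB.instance Definition _ :=
  GRing.isZmodMorphism.Build {poly int} KVar Z_L_to_KVar Z_L_to_KVar_zmod.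
HB.instance Definition _ :=
  GRing.isMonoidMorphism.Build {poly int} KVar Z_L_to_KVar Z_L_to_KVar_monoid.

Definition KVar_scale (p : {poly int}) (x : KVar) : KVar := Z_L_to_KVar p * x.

Fact KVar_scaleA p q x : KVar_scale p (KVar_scale q x) = KVar_scale (p * q) x.
Proof. by rewrite /KVar_scale mulrA rmorphM. Qed.
Fact KVar_scale1 : left_id 1 KVar_scale.
Proof. by move=> x; rewrite /KVar_scale rmorph1 mul1r. Qed.
Fact KVar_scaleDr : right_distributive KVar_scale +%R.
Proof. by move=> p x y; rewrite /KVar_scale mulrDr. Qed.
Fact KVar_scaleDl x : {morph KVar_scale^~ x : p q / p + q}.
Proof. by move=> p q; rewrite /KVar_scale rmorphD mulrDl. Qed.
HB.instance Definition _ := GRing.Zmodule_isLmodule.Build {poly int} KVar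
  KVar_scaleA KVar_scale1 KVar_scaleDr KVar_scaleDl.

(** * Localization of rings and modules *)

Record mult_subset (A : comNzRingType) := MultSubset {
  mult_mem :> A -> Prop;
  mult_mem1 : mult_mem 1;
  mult_memM : forall a b, mult_mem a -> mult_mem b -> mult_mem (a * b)
}.

Section Saturated.
Variables (A : comNzRingType) (B : A -> Prop).

Inductive saturated_gen : A -> Prop :=
| saturated_gen_base b : B b -> saturated_gen b
| saturated_gen1 : saturated_gen 1
| saturated_genM a b :
    saturated_gen a -> saturated_gen b -> saturated_gen (a * b)
| saturated_gen_div a b : saturated_gen (a * b) -> saturated_gen a.

Definition saturated_mult_subset : mult_subset A :=
  MultSubset saturated_gen1 saturated_genM.

End Saturated.

Section LocalizationModule.
Variables (A : comNzRingType) (S : mult_subset A) (M : lmodType A).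

Definition denominator := {s : A | `[< S s >]}.
HB.instance Definition _ := Choice.on denominator.

Definition denom1 : denominator := exist _ 1 (asboolT (mult_mem1 S)).
Definition denomM (s t : denominator) : denominator :=
  exist _ (sval s * sval t)
    (asboolT (mult_memM (asboolW (valP s)) (asboolW (valP t)))).

Definition fraction := (M * denominator)%type.
HB.instance Definition _ := Choice.on fraction.

(* x / s = y / t iff u (t x) = u (s y) for some u in S. *)
Definition fraction_eq (x y : fraction) : bool :=
  `[< exists2 u, S u & u *: (sval y.2 *: x.1) = u *: (sval x.2 *: y.1) >].

Lemma fraction_eq_equiv : equiv_class_of fraction_eq.
Proof.
split=> [x|x y|y x z].
- by apply/asboolP; exists 1 => //; apply: mult_mem1.
- by apply/asboolP/asboolP=> -[u Su e]; exists u.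
move=> /asboolP[u Su eu] /asboolP[v Sv ev]; apply/asboolP.
exists (u * v * sval y.2).
  by do 2?apply: mult_memM => //; apply: asboolW (valP y.2).
rewrite !scalerA in eu ev *.
transitivity ((v * sval z.2) *: ((u * sval y.2) *: x.1)).
  by rewrite scalerA; congr (_ *: _); ring.
rewrite eu scalerA; transitivity ((u * sval x.2) *: ((v * sval z.2) *: y.1)).
  by rewrite scalerA; congr (_ *: _); ring.
by rewrite ev scalerA; congr (_ *: _); ring.
Qed.

Canonical fraction_equiv := EquivRelPack fraction_eq_equiv.
Canonical fraction_encModRel := defaultEncModRel fraction_eq.

Definition localization := {eq_quot fraction_eq}.
HB.instance Definition _ := EqQuotient.on localization.
HB.instance Definition _ := Choice.on localization.

Definition frac (x : M) (s : denominator) : localization := \pi_localization (x, s).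

Lemma fracP x y s t :
  (frac x s = frac y t) <->
  (exists2 u, S u & u *: (sval t *: x) = u *: (sval s *: y)).
Proof.
split=> [/eqP|h]; last apply/eqP; rewrite /frac piE.
  by move/asboolP.
exact/asboolP.
Qed.

Lemma fracW (P : localization -> Prop) :
  (forall x s, P (frac x s)) -> forall z, P z.
Proof. by move=> h; apply: quotW => -[]. Qed.

Lemma frac_repr z : frac (repr z).1 (repr z).2 = z.
Proof. by rewrite /frac -surjective_pairing reprK. Qed.

Lemma frac_eq x y s t : sval t *: x = sval s *: y -> frac x s = frac y t.
Proof. by move=> e; apply/fracP; exists 1; rewrite ?e //; apply: mult_mem1. Qed.

Definition loc_add (z w : localization) : localization :=
  frac (sval (repr w).2 *: (repr z).1 + sval (repr z).2 *: (repr w).1)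
       (denomM (repr z).2 (repr w).2).

Definition loc_opp (z : localization) : localization :=
  frac (- (repr z).1) (repr z).2.

Lemma frac_add x y s t :
  loc_add (frac x s) (frac y t) = frac (sval t *: x + sval s *: y) (denomM s t).
Proof.
rewrite /loc_add.
have /fracP[u Su] := frac_repr (frac x s).
have /fracP[v Sv] := frac_repr (frac y t).
move: (repr (frac x s)) (repr (frac y t)) => [x' s'] [y' t'] /= ev eu.
apply/fracP; exists (u * v); first exact: mult_memM.
rewrite /= !scalerDr !scalerA in ev eu *; congr (_ + _).
  transitivity ((v * sval t * sval t') *: ((u * sval s) *: x')).
    by rewrite scalerA; congr (_ *: _); ring.
  by rewrite eu scalerA; congr (_ *: _); ring.
transitivity ((u * sval s * sval s') *: ((v * sval t) *: y')).
  by rewrite scalerA; congr (_ *: _); ring.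
by rewrite ev scalerA; congr (_ *: _); ring.
Qed.

Lemma frac_opp x s : loc_opp (frac x s) = frac (- x) s.
Proof.
rewrite /loc_opp; have /fracP[u Su e] := frac_repr (frac x s).
by apply/fracP; exists u; rewrite // !scalerN e.
Qed.

Fact loc_addA : associative loc_add.
Proof.
elim/fracW=> x s; elim/fracW=> y t; elim/fracW=> z u; rewrite !frac_add.
apply: frac_eq; rewrite /= !scalerDr !scalerA -!addrA.
by congr (_ *: _ + (_ *: _ + _ *: _)); ring.
Qed.
Fact loc_addC : commutative loc_add.
Proof.
elim/fracW=> x s; elim/fracW=> y t; rewrite !frac_add.
by apply: frac_eq; rewrite /= addrC mulrC.
Qed.
Fact loc_add0 : left_id (frac 0 denom1) loc_add.
Proof.
elim/fracW=> x s; rewrite frac_add.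
by apply: frac_eq; rewrite /= scaler0 add0r mul1r scale1r.
Qed.
Fact loc_addN : left_inverse (frac 0 denom1) loc_opp loc_add.
Proof.
elim/fracW=> x s; rewrite frac_opp frac_add.
by apply: frac_eq; rewrite /= scalerN addNr !scaler0.
Qed.
HB.instance Definition _ := GRing.isZmodule.Build localization
  loc_addA loc_addC loc_add0 loc_addN.

Lemma fracD x y s t :
  frac x s + frac y t = frac (sval t *: x + sval s *: y) (denomM s t).
Proof. exact: frac_add. Qed.

End LocalizationModule.

Section LocalizationRing.
Variables (A : comNzRingType) (S : mult_subset A).

(* S^-1 A. *)
Definition loc_ring := localization S A^o.
HB.instance Definition _ := GRing.Zmodule.on loc_ring.

Definition loc_scale (M : lmodType A) (a : loc_ring) (x : localization S M) :
    localization S M :=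
  @frac A S M (((repr a).1 : A) *: (repr x).1) (denomM (repr a).2 (repr x).2).

Lemma loc_scaleE (M : lmodType A) (a : A) (x : M) s t :
  loc_scale (frac (a : A^o) s) (frac x t) = frac (a *: x) (denomM s t).
Proof.
rewrite /loc_scale.
have /fracP[u Su] := frac_repr (frac (a : A^o) s).
have /fracP[v Sv] := frac_repr (frac x t).
move: (repr (frac _ s)) (repr (frac _ t)) => [a' s'] [x' t'] /= ev eu.
apply/fracP; exists (u * v); first exact: mult_memM.
rewrite /= !scalerA in ev eu *; rewrite /GRing.scale /= in eu.
transitivity ((u * sval s * a') *: ((v * sval t) *: x')).
  by rewrite scalerA; congr (_ *: _); ring.
by rewrite ev eu scalerA; congr (_ *: _); ring.
Qed.

Definition loc_one : loc_ring := frac (1 : A^o) (denom1 S).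
Definition loc_mul : loc_ring -> loc_ring -> loc_ring := @loc_scale A^o.

Fact loc_scaleA (M : lmodType A) (a b : loc_ring) (x : localization S M) :
  loc_scale a (loc_scale b x) = loc_scale (loc_mul a b) x.
Proof.
elim/fracW: a => a s; elim/fracW: b => b t; elim/fracW: x => x u.
rewrite [loc_scale (frac b t) _]loc_scaleE [loc_mul _ _]loc_scaleE !loc_scaleE.
apply: frac_eq; rewrite /= !scalerA.
by congr (_ *: _); rewrite /GRing.scale /=; ring.
Qed.
Fact loc_scale1 (M : lmodType A) : left_id loc_one (@loc_scale M).
Proof.
elim/fracW=> x s; rewrite loc_scaleE.
by apply: frac_eq; rewrite /= mul1r scale1r.
Qed.
Fact loc_scaleDr (M : lmodType A) : right_distributive (@loc_scale M) +%R.
Proof.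
elim/fracW=> a s; elim/fracW=> x t; elim/fracW=> y u.
rewrite fracD !loc_scaleE fracD; apply: frac_eq; rewrite /= !scalerDr !scalerA.
by congr (_ *: _ + _ *: _); ring.
Qed.
Fact loc_scaleDl (M : lmodType A) (x : localization S M) :
  {morph (@loc_scale M)^~ x : a b / a + b}.
Proof.
elim/fracW: x => x u; elim/fracW=> a s; elim/fracW=> b t.
rewrite [X in loc_scale X]fracD !loc_scaleE fracD; apply: frac_eq.
rewrite /= !scalerDl !scalerDr !scalerA.
by congr (_ *: _ + _ *: _); rewrite /GRing.scale /=; ring.
Qed.
Fact loc_mulC : commutative loc_mul.
Proof.
elim/fracW=> a s; elim/fracW=> b t; rewrite /loc_mul !loc_scaleE.
by apply: frac_eq; rewrite /GRing.scale /=; ring.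
Qed.

HB.instance Definition _ := GRing.Zmodule_isComPzRing.Build loc_ring
  (@loc_scaleA A^o) loc_mulC (@loc_scale1 A^o) (fun a b c => @loc_scaleDl A^o c a b).

HB.instance Definition _ (M : lmodType A) :=
  GRing.Zmodule_isLmodule.Build loc_ring (localization S M)
    (@loc_scaleA M) (@loc_scale1 M) (@loc_scaleDr M) (@loc_scaleDl M).

End LocalizationRing.

(* The canonical map M -> S^-1 M. *)
Definition loc_map (A : comNzRingType) (S : mult_subset A) (M : lmodType A)
  (x : M) : localization S M := frac x (denom1 S).

Definition generates (A : pzRingType) (M : lmodType A) (B : M -> Prop) : Prop :=
  forall x : M, exists s : seq (A * M),
    (forall p, p \in s -> B p.2) /\ x = \sum_(p <- s) p.1 *: p.2.

(** * The localized Grothendieck ring *)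

(* The saturated multiplicative subset generated by the L^n - 1, n > 0. *)
Definition S' : mult_subset {poly int} :=
  saturated_mult_subset (fun p => exists2 n, (0 < n)%N & p = 'X^n - 1).

(* Main.v *)
(* Counting points modulo p gives, for almost all primes p, a ring homomorphism
   [X] |-> #X(F_p) from K(Var) to F_p, which kills L.  The elements of S' become
   units of Z modulo L, so if the count of each [Y_G] is, for almost all p, the
   residue of an integer independent of p, the same holds for every class in the
   module they generate.  This is the case: if G has a non-loop edge, the degree
   of psi_G is less than the number of variables and Chevalley-Warning gives
   #Y_G(F_p) = 0 mod p; otherwise psi_G is the product of the variables and
   #Y_G(F_p) = (-1)^n mod p.  But Spec Q(i) has 2 or 0 points according to
   p mod 4.

   Only the images modulo almost all p exist, since a variety over Q has no
   canonical reduction.  That identities between loci over algC persist over F_p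
   for large p follows from the Nullstellensatz: counterexamples for infinitely
   many p yield, along an ultrafilter, a prime ideal of Z[x_1, ..., x_n] of
   characteristic zero, hence a counterexample over algC. *)

Require Import Defs.
From HB Require Import structures.
From mathcomp Require Import boolp classical_sets filter.
From mathcomp Require Import all_boot all_order all_algebra all_field.
From mathcomp Require Import ring zify.
From mathcomp.finmap Require finmap.
From mathcomp.multinomials Require monalg.
From mathcomp Require Import mpoly.

Set Implicit Arguments.
Unset Strict Implicit.
Unset Printing Implicit Defensive.

Import Order.TTheory GRing.Theory Num.Theory.
Local Open Scope ring_scope.

(** * Homomorphisms to the algebraic numbers *)

(** Each relation survives reduction only beyond a bound on [p] that depends on it, so the counts
    live on the free ring, one homomorphism for each [p], and descend to classes for almost all
    primes only. Two obstacles shape the reduction of a relation. A regular map over [algC] is a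
    bare function with a local formula near each point; the transfer principle therefore accepts an
    infinite family of equations and returns a finite subfamily, which yields finitely many charts.
    And transfer handles quantifier-free conditions on vanishing, while proportionality and images
    are existential; 2 x 2 minors express them without quantifiers. The limit point over [algC] must
    also keep finitely many polynomials nonzero, which is why prime ideals are wanted as
    intersections of kernels and not merely inside one kernel. *)

Record prime_ideal (A : comNzRingType) (I : A -> Prop) : Prop := PrimeIdeal {
  prime_ideal0 : I 0;
  prime_idealD : forall a b, I a -> I b -> I (a + b);
  prime_idealMl : forall a b, I b -> I (a * b);
  prime_ideal1 : ~ I 1;
  prime_idealP : forall a b, I (a * b) -> I a \/ I b
}.

Section PrimeIdeal.
Variables (A : comNzRingType) (I : A -> Prop) (PI : prime_ideal I).

Lemma prime_idealMr a b : I a -> I (a * b).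
Proof. by rewrite mulrC; apply: prime_idealMl. Qed.

Lemma prime_idealB a b : I a -> I b -> I (a - b).
Proof.
move=> Ia Ib; apply: prime_idealD => //.
by rewrite -mulN1r; apply: prime_idealMl.
Qed.

Lemma prime_idealX a k : I (a ^+ k) -> I a.
Proof.
elim: k => [/(prime_ideal1 PI) //|k IHk]; rewrite exprS.
by case/(prime_idealP PI).
Qed.

Lemma prime_ideal_sum (J : Type) (r : seq J) (P : pred J) (F : J -> A) :
  (forall i, P i -> I (F i)) -> I (\sum_(i <- r | P i) F i).
Proof.
move=> IF; elim/big_ind: _ => //; first exact: prime_ideal0.
exact: prime_idealD.
Qed.

Lemma prime_ideal_prod (J : eqType) (r : seq J) (P : pred J) (F : J -> A) :
  I (\prod_(i <- r | P i) F i) -> exists i, [/\ i \in r, P i & I (F i)].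
Proof.
elim: r => [|i r IHr]; first by rewrite big_nil => /(prime_ideal1 PI).
rewrite big_cons; case Pi: (P i).
  case/(prime_idealP PI) => [IFi|/IHr[j [jr Pj IFj]]].
    by exists i; rewrite mem_head.
  by exists j; rewrite inE jr orbT.
by case/IHr=> j [jr Pj IFj]; exists j; rewrite inE jr orbT.
Qed.

End PrimeIdeal.

(* Every prime of characteristic zero is an intersection of kernels of
   homomorphisms to [algC]. *)
Definition specializable (A : comNzRingType) : Prop :=
  forall I : A -> Prop, prime_ideal I -> (forall k : int, I k%:~R -> k = 0) ->
  forall g, ~ I g ->
  exists2 psi : {rmorphism A -> algC}, forall a, I a -> psi a = 0 & psi g != 0.

Lemma specializable_int : specializable int.
Proof.
move=> I PI I0 g Ig; exists (intr : {rmorphism int -> algC}) => [a Ia|].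
  by rewrite (I0 a) ?intz.
by rewrite intr_eq0; apply/eqP => g0; apply: Ig; rewrite g0; apply: prime_ideal0.
Qed.

Section SpecializablePoly.
Variables (A : comNzRingType) (specA : specializable A).
Variables (I : {poly A} -> Prop) (PI : prime_ideal I).
Hypothesis I_int : forall k : int, I k%:~R -> k = 0.
Implicit Types f g m q r : {poly A}.

(** [J] is the contraction of the prime to [A], and [JX] its extension back to [{poly A}], tested on
    coefficients; together they allow work in (A/J)[X] without forming the quotient. *)
Let J (a : A) : Prop := I a%:P.
Let JX f : Prop := forall i, J f`_i.

Let PJ : prime_ideal J.
Proof.
split; rewrite /J; first by rewrite polyC0; apply: prime_ideal0.
- by move=> a b Ja Jb; rewrite polyCD; apply: prime_idealD.
- by move=> a b Jb; rewrite polyCM; apply: prime_idealMl.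
- by rewrite polyC1; apply: prime_ideal1.
by move=> a b; rewrite polyCM; apply: prime_idealP.
Qed.

Let J_int (k : int) : J k%:~R -> k = 0.
Proof. by rewrite /J rmorph_int; apply: I_int. Qed.

Let JX_I f : JX f -> I f.
Proof.
move=> Jf; rewrite -[f]coefK poly_def; apply: prime_ideal_sum => // i _.
by rewrite -mul_polyC; apply: prime_idealMr => //; apply: Jf.
Qed.

(** Dropping the top coefficients that lie in [J] gives a representative modulo [JX] whose size
    shows the degree over A/J. *)
Let JX_head f :
  exists f', [/\ JX (f - f'), (size f' <= size f)%N
               & JX f \/ ~ J (lead_coef f')].
Proof.
have [Jf|nJf] := pselect (JX f).
  by exists 0; rewrite subr0 size_poly0; split=> //; left.
have /existsNP[i0 Ji0] := nJf.
have exP : exists i, `[< ~ J f`_i >] by exists i0; apply/asboolP.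
have bound i : `[< ~ J f`_i >] -> (i <= size f)%N.
  move/asboolP; apply: contra_notT; rewrite -ltnNge => /ltnW le_fi.
  by rewrite nth_default //; apply: prime_ideal0.
case: (ex_maxnP exP bound) => i /asboolP Ji maxi.
have ne0 : f`_i != 0.
  by apply/eqP => fi0; apply: Ji; rewrite fi0; apply: prime_ideal0.
have lt_if : (i < size f)%N.
  by rewrite ltnNge; apply: contra ne0 => le_fi; rewrite nth_default.
exists (\poly_(j < i.+1) f`_j); split.
- move=> j; rewrite coefB coef_poly ltnS; case: leqP => [_|lt_ij].
    by rewrite subrr; apply: prime_ideal0.
  rewrite subr0; apply: contrapT => Jj.
  by have := maxi j (asboolT Jj); rewrite leqNgt lt_ij.
- exact: leq_trans (size_poly _ _) lt_if.
by right; rewrite lead_coef_poly.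
Qed.

Let horner_map (psi : {rmorphism A -> algC}) (t : algC) :
  {rmorphism {poly A} -> algC} := horner_eval t \o map_poly psi.

(** Here X is transcendental over Frac(A/J): once [psi] keeps one coefficient of [g] nonzero, X may
    be sent to any value that is not a root of the image of [g]. *)
Let specializable_transcendental g :
  (forall f, I f -> JX f) -> ~ I g ->
  exists2 psi : {rmorphism {poly A} -> algC},
    forall a, I a -> psi a = 0 & psi g != 0.
Proof.
move=> IJ Ig; have /existsNP[i Ji] : ~ JX g by move/JX_I.
have [psi psiJ psi_gi] := specA PJ J_int Ji.
have [t gt] : exists t, (map_poly psi g).[t] != 0.
  set h := map_poly psi g.
  have h0 : h != 0.
    apply/eqP => /polyP/(_ i); rewrite coef_map coef0 => /eqP.
    by rewrite (negPf psi_gi).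
  (* At a root of h - 1 the value of h is 1. Only a nonzero constant h - 1 has no root, and then h
     is itself a nonzero constant. *)
  have [/eqP/size_poly1P[c c0 hc]|/closed_rootP[t]] := eqVneq (size (h - 1)) 1%N.
    exists 0; apply: contra h0 => /eqP h00.
    have /polyP/(_ 0) : h = (c + 1)%:P by rewrite polyCD polyC1 -hc subrK.
    rewrite -horner_coef0 h00 coefC /= => c1; apply/eqP.
    by rewrite -[h](subrK 1) hc -polyC1 -polyCD -c1.
  rewrite rootE !hornerE subr_eq0 => /eqP ht; exists t.
  by rewrite ht oner_neq0.
exists (horner_map psi t) => //= f /IJ Jf.
suff -> : map_poly psi f = 0 by rewrite /horner_eval horner0.
by apply/polyP => j; rewrite coef_map coef0; apply: psiJ.
Qed.

Section Algebraic.
(** [m] stands for the minimal polynomial of X over Frac(A/J). Its leading coefficient is only known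
    to lie outside [J], hence the pseudo-divisions below. *)
Variable m : {poly A}.
Hypotheses (Im : I m) (Jm : ~ J (lead_coef m)).
Hypothesis min_m : forall f, I f -> (size f < size m)%N -> JX f.

Let divp_m f : exists k q r,
  [/\ lead_coef m ^+ k *: f = q * m + r, (size r < size m)%N & I f -> I r].
Proof.
exists (Pdiv.Ring.rscalp f m), (Pdiv.Ring.rdivp f m), (Pdiv.Ring.rmodp f m).
have := Pdiv.ComRing.rdivp_eq m f; set r := Pdiv.Ring.rmodp f m => e.
split=> // [|If].
  rewrite Pdiv.Ring.ltn_rmodp; apply/eqP => m0; apply: Jm.
  by rewrite m0 lead_coef0; apply: prime_ideal0.
rewrite -(addKr (Pdiv.Ring.rdivp f m * m) r) -e addrC.
apply: prime_idealB => //; last exact: prime_idealMl.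
by rewrite -mul_polyC; apply: prime_idealMl.
Qed.

(* Minimal polynomials are irreducible: an element of minimal degree in the
   ideal generated by [g] and [I] has degree zero modulo [J]. *)
Let coprime_m g : ~ I g -> exists h e, ~ J e /\ I (h * g - e%:P).
Proof.
move=> Ig.
pose P f := ~ J (lead_coef f) /\ exists h, I (f - h * g).
have exP : exists s, `[< exists2 f, P f & size f = s >].
  exists (size m); apply/asboolP; exists m => //; split=> //.
  by exists 0; rewrite mul0r subr0.
case: (ex_minnP exP) => _ /asboolP[n [Jn [h Inh]] <-] min_n.
have n0 : n != 0.
  by apply/eqP => n0; apply: Jn; rewrite n0 lead_coef0; apply: prime_ideal0.
have div_n f u : I (f - u * g) ->
    exists k q r, lead_coef n ^+ k *: f = q * n + r /\ JX r.
  move=> Ifu; exists (Pdiv.Ring.rscalp f n), (Pdiv.Ring.rdivp f n).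
  exists (Pdiv.Ring.rmodp f n); split; first exact: Pdiv.ComRing.rdivp_eq.
  have := Pdiv.ComRing.rdivp_eq n f; have := Pdiv.Ring.ltn_rmodp f n.
  set r := Pdiv.Ring.rmodp f n; set q := Pdiv.Ring.rdivp f n.
  set c := lead_coef n ^+ _; rewrite n0 => lt_r e.
  have [r' [Jrr' le_r' [//|Jr']]] := JX_head r.
  have : (size n <= size r')%N.
    apply: min_n; apply/asboolP; exists r' => //; split=> //.
    exists (c *: u - q * h).
    have -> : r' - (c *: u - q * h) * g
            = c%:P * (f - u * g) - q * (n - h * g) - (r - r').
      rewrite !mulrBr mul_polyC e -!mul_polyC; ring.
    apply: (prime_idealB PI); last exact: JX_I.
    by apply: (prime_idealB PI); apply: (prime_idealMl PI).
  by rewrite leqNgt (leq_ltn_trans le_r' lt_r).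
have In : ~ I n.
  move=> In; have [|k [q [r [e Jr]]]] := div_n g 1.
    by rewrite mul1r subrr; apply: prime_ideal0.
  have : I ((lead_coef n ^+ k)%:P * g).
    rewrite mul_polyC e; apply: prime_idealD => //; last exact: JX_I.
    exact: prime_idealMl.
  by case/(prime_idealP PI) => // /(prime_idealX PJ).
have [|k [q [r [e Jr]]]] := div_n m 0; first by rewrite mul0r subr0.
(* Modulo [JX], q n is a multiple of [m], so it lies in [I]; as n does not, q does, and by
   minimality of [m] its degree over A/J is at least that of [m]. *)
have Iq : I q.
  suff : I (q * n) by case/(prime_idealP PI).
  rewrite -(addrK r (q * n)) -e -mul_polyC.
  by apply: (prime_idealB PI); [apply: (prime_idealMl PI) | apply: JX_I].
have JXM f f' : JX f -> JX (f * f').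
  move=> Jf i; rewrite coefM; apply: prime_ideal_sum => // j _.
  exact: prime_idealMr.
have [q' [Jqq' le_q' JJ]] := JX_head q.
have {JJ}Jq' : ~ J (lead_coef q').
  case: JJ => // Jq _; apply: Jm.
  have : J ((lead_coef n ^+ k *: m)`_(size m).-1).
    by rewrite e coefD; apply: prime_idealD => //; apply: JXM.
  by rewrite coefZ; case/(prime_idealP PJ) => // /(prime_idealX PJ).
have le_mq' : (size m <= size q')%N.
  rewrite leqNgt; apply/negP => /min_m lt_q'; apply: Jq'; apply: lt_q'.
  by rewrite -(subKr q q'); apply: prime_idealB => //; apply: JX_I.
(* If n had positive degree, the product of the leading coefficients of q' and n would sit in a
   degree where [m] has no coefficient, hence lie in [J]. *)
have sn1 : size n = 1%N.
  apply/eqP; rewrite eqn_leq size_poly_gt0 n0 andbT leqNgt; apply/negP => gt_n.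
  have : J (lead_coef q' * lead_coef n).
    rewrite mul_lead_coef; set i := (_.-2).
    have -> : q' * n = lead_coef n ^+ k *: m - (q - q') * n - r.
      by rewrite e; ring.
    rewrite !coefB; apply: prime_idealB => //; apply: prime_idealB => //.
      rewrite coefZ nth_default ?mulr0; first exact: prime_ideal0.
      rewrite {}/i; move: (size m) (size q') (size n) le_mq' gt_n => a b c; lia.
    exact: JXM.
  by case/(prime_idealP PJ).
exists h, (lead_coef n); split=> //.
have nE : n = (n`_0)%:P by apply: size1_polyC; rewrite sn1.
have -> : (lead_coef n)%:P = n by rewrite lead_coefE sn1 {2}nE.
by rewrite -opprB -mulN1r; apply: prime_idealMl.
Qed.

(** The homomorphism on [A] keeps e * lead_coef m nonzero. The leading coefficient preserves the
    degree of [m], so a root t exists, and lets pseudo-division by [m] kill all of [I] at t; as h g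
    = e modulo [I], the factor e keeps [g] nonzero. *)
Lemma specializable_algebraic g : ~ I g ->
  exists2 psi : {rmorphism {poly A} -> algC},
    forall a, I a -> psi a = 0 & psi g != 0.
Proof.
move=> Ig; have [h [e [Je Ihe]]] := coprime_m Ig.
have Jec : ~ J (e * lead_coef m) by case/(prime_idealP PJ).
have [psi psiJ] := specA PJ J_int Jec.
rewrite rmorphM mulf_eq0 => /norP[psi_e psi_c].
have [t mt] : exists t, root (map_poly psi m) t.
  apply/closed_rootP; rewrite size_map_poly_id0 //.
  apply/eqP => sm1; apply: Jm; rewrite /J lead_coefE sm1 /=.
  by rewrite -size1_polyC ?sm1.
have psiP f : I f -> horner_map psi t f = 0.
  move=> If; have [k [q [r [e1 lt_r /(_ If)/min_m/(_ lt_r) Jr]]]] := divp_m f.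
  have /(congr1 (horner_map psi t)) := e1.
  have -> : horner_map psi t (q * m + r) = 0.
    rewrite rmorphD rmorphM /= /horner_eval (rootP mt) mulr0 add0r.
    suff -> : map_poly psi r = 0 by rewrite horner0.
    by apply/polyP => j; rewrite coef_map coef0; apply: psiJ.
  rewrite -mul_polyC rmorphM => /eqP; rewrite mulf_eq0 => /orP[|/eqP //].
  rewrite /= /horner_eval map_polyC hornerC /= rmorphXn expf_eq0 (negPf psi_c).
  by rewrite andbF.
exists (horner_map psi t) => //.
have /eqP := psiP _ Ihe; rewrite rmorphB rmorphM subr_eq0.
apply: contraTneq => ->; rewrite mulr0 eq_sym.
by rewrite /= /horner_eval map_polyC hornerC.
Qed.

End Algebraic.

Lemma specializable_poly_aux g : ~ I g ->
  exists2 psi : {rmorphism {poly A} -> algC},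
    forall a, I a -> psi a = 0 & psi g != 0.
Proof.
have [IJ|/existsNP[f /not_implyP[If nJf]]] := pselect (forall f, I f -> JX f).
  exact: specializable_transcendental.
have exP : exists s, `[< exists2 m, I m /\ ~ J (lead_coef m) & size m = s >].
  have [f' [Jff' _ [//|Jf']]] := JX_head f.
  exists (size f'); apply/asboolP; exists f' => //; split=> //.
  by rewrite -(subKr f f'); apply: prime_idealB => //; apply: JX_I.
case: (ex_minnP exP) => _ /asboolP[m [Im Jm] <-] min_m.
apply: (specializable_algebraic Im Jm) => f0 If0 lt_f0.
have [f' [Jff' le_f' [//|Jf']]] := JX_head f0.
have : (size m <= size f')%N.
  apply: min_m; apply/asboolP; exists f' => //; split=> //.
  by rewrite -(subKr f0 f'); apply: prime_idealB => //; apply: JX_I.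
by rewrite leqNgt (leq_ltn_trans le_f' lt_f0).
Qed.

End SpecializablePoly.

Lemma specializable_poly (A : comNzRingType) :
  specializable A -> specializable {poly A}.
Proof. by move=> specA I PI I_int g; apply: specializable_poly_aux. Qed.

Lemma specializable_retract (A B : comNzRingType)
    (s : {rmorphism A -> B}) (r : {rmorphism B -> A}) :
  cancel s r -> specializable B -> specializable A.
Proof.
move=> sK specB I PI I_int g Ig.
have [|||psi psiI psi_g] := specB (fun b => I (r b)) _ _ (s g).
- split; rewrite ?rmorph0 ?rmorph1; [exact: prime_ideal0 | | | exact: prime_ideal1 | ].
  + by move=> a b Ia Ib; rewrite rmorphD; apply: prime_idealD.
  + by move=> a b Ib; rewrite rmorphM; apply: prime_idealMl.
  by move=> a b; rewrite rmorphM; apply: prime_idealP.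
- by move=> k; rewrite rmorph_int; apply: I_int.
- by rewrite sK.
by exists (psi \o s) => //= a Ia; apply: psiI; rewrite sK.
Qed.

Lemma specializable_mpoly n : specializable {mpoly int[n]}.
Proof.
elim: n => [|n IHn].
  apply: (@specializable_retract _ int (meval (fun _ => 0)) (@mpolyC 0 int));
    last exact: specializable_int.
  move=> p /=; rewrite [RHS]mpolyE mevalE raddf_sum /=; apply: eq_bigr => m _.
  rewrite big_ord0 mulr1 -mul_mpolyC -[LHS]mulr1; congr (_ * _).
  by rewrite -mpolyX0; congr 'X_[_]; apply/mnmP => -[].
apply: (@specializable_retract _ _ (@muni n int)
          (horner_eval 'X_ord_max \o map_poly (@mwiden n int)));
  last exact: specializable_poly.
move=> p /=; rewrite muniE rmorph_sum /horner_eval horner_sum [RHS]mpolyE.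
apply: eq_bigr => m _ /=.
rewrite -mul_polyC rmorphM /= map_polyC map_polyXn hornerM.
rewrite hornerC hornerXn /= mwidenZ mwidenX -scalerAl; congr (_ *: _).
rewrite mpolyXn -mpolyXD; congr 'X_[_]; apply/mnmP => i.
rewrite mnmDE mulmnE mnm1E eq_sym; case: (unliftP ord_max i) => [j ->|->].
  have -> : lift ord_max j = widen_ord (leqnSn n) j.
    by apply: val_inj; rewrite /= /bump leqNgt ltn_ord.
  rewrite mnmwiden_widen mnmE -val_eqE /= ltn_eqF //.
  by rewrite mul0n addn0.
by rewrite mnmwiden_ordmax eqxx mul1n.
Qed.

(** * Transfer from algC to almost all F_p *)

(* Evaluation of an integral polynomial at a point over any ring. Taking for [R]
   another polynomial ring, it is also substitution. *)
Definition zeval (R : comNzRingType) n (x : 'rV[R]_n) :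
    {rmorphism {mpoly int[n]} -> R} :=
  meval (x 0) \o map_mpoly intr.

Lemma zevalX (R : comNzRingType) n (x : 'rV[R]_n) i : zeval x 'X_i = x 0 i.
Proof. by rewrite /= map_mpolyX mevalXU. Qed.

Lemma rmorph_mpolyE (R : comNzRingType) n (f : {rmorphism {mpoly int[n]} -> R}) p :
  f p = \sum_(m <- msupp p) (p@_m)%:~R * \prod_i f 'X_i ^+ m i.
Proof.
rewrite {1}[p]mpolyE rmorph_sum /=; apply: eq_bigr => m _.
rewrite -[p@_m in LHS]intz scaler_int rmorphMz -mulrzl; congr (_ * _).
by rewrite mpolyXE_id rmorph_prod; apply: eq_bigr => i _; apply: rmorphXn.
Qed.

Lemma zevalE (R : comNzRingType) n (x : 'rV[R]_n) p :
  zeval x p = \sum_(m <- msupp p) (p@_m)%:~R * \prod_i x 0 i ^+ m i.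
Proof.
rewrite rmorph_mpolyE; apply: eq_bigr => m _; congr (_ * _).
by apply: eq_bigr => i _; rewrite zevalX.
Qed.

Lemma zeval_unique (R : comNzRingType) n (f : {rmorphism {mpoly int[n]} -> R}) p :
  f p = zeval (\row_i f 'X_i) p.
Proof.
rewrite rmorph_mpolyE zevalE; apply: eq_bigr => m _; congr (_ * _).
by apply: eq_bigr => i _; rewrite mxE.
Qed.

Lemma rmorph_zeval (R S : comNzRingType) (h : {rmorphism R -> S}) n
    (x : 'rV[R]_n) p :
  h (zeval x p) = zeval (map_mx h x) p.
Proof.
rewrite -[LHS]/((h \o zeval x) p) [LHS]zeval_unique.
set z := \row_i _; suff -> : z = map_mx h x by [].
by apply/rowP => i; rewrite !mxE; congr (h _); apply: zevalX.
Qed.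

Definition vanish (F : fieldType) n (x : 'rV[F]_n) (p : {mpoly int[n]}) : bool :=
  zeval x p == 0.

Section Vanish.
Variables (F : fieldType) (n : nat) (x : 'rV[F]_n).
Implicit Types p q : {mpoly int[n]}.

Lemma vanish0 : vanish x 0.
Proof. by rewrite /vanish rmorph0. Qed.

Lemma vanish1 : vanish x 1 = false.
Proof. by rewrite /vanish rmorph1 oner_eq0. Qed.

Lemma vanishD p q : vanish x p -> vanish x q -> vanish x (p + q).
Proof. by rewrite /vanish rmorphD => /eqP-> /eqP->; rewrite addr0. Qed.

Lemma vanishM p q : vanish x (p * q) = vanish x p || vanish x q.
Proof. by rewrite /vanish rmorphM mulf_eq0. Qed.

Lemma vanish_int (k : int) : vanish x k%:~R = (k%:~R == 0 :> F).
Proof. by rewrite /vanish rmorph_int. Qed.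

Lemma vanishX i : vanish x 'X_i = (x 0 i == 0).
Proof. by rewrite /vanish zevalX. Qed.

End Vanish.

(* A condition on [v], where [v p] says whether [p] vanishes, is a
   quantifier-free formula. *)
Definition finitary n (phi : ({mpoly int[n]} -> bool) -> bool) : Prop :=
  exists s : seq {mpoly int[n]}, forall v w, {in s, v =1 w} -> phi v = phi w.

Section Finitary.
Variable n : nat.
Implicit Types (p : {mpoly int[n]}) (phi psi : ({mpoly int[n]} -> bool) -> bool).

Lemma finitary_const b : finitary (fun _ : {mpoly int[n]} -> bool => b).
Proof. by exists [::]. Qed.

Lemma finitary_atom p : finitary (fun v => v p).
Proof. by exists [:: p] => v w; apply; apply: mem_head. Qed.

Lemma finitary_neg phi : finitary phi -> finitary (fun v => ~~ phi v).
Proof. by case=> s hs; exists s => v w /hs ->. Qed.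

Lemma finitary_and phi psi :
  finitary phi -> finitary psi -> finitary (fun v => phi v && psi v).
Proof.
case=> s hs [t ht]; exists (s ++ t) => v w vw.
by rewrite (hs v w) ?(ht v w) // => p ps; apply: vw; rewrite mem_cat ps ?orbT.
Qed.

Lemma finitary_or phi psi :
  finitary phi -> finitary psi -> finitary (fun v => phi v || psi v).
Proof.
case=> s hs [t ht]; exists (s ++ t) => v w vw.
by rewrite (hs v w) ?(ht v w) // => p ps; apply: vw; rewrite mem_cat ps ?orbT.
Qed.

Lemma finitary_imply phi psi :
  finitary phi -> finitary psi -> finitary (fun v => phi v ==> psi v).
Proof.
case=> s hs [t ht]; exists (s ++ t) => v w vw.
by rewrite (hs v w) ?(ht v w) // => p ps; apply: vw; rewrite mem_cat ps ?orbT.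
Qed.

Lemma finitary_eqb phi psi :
  finitary phi -> finitary psi -> finitary (fun v => phi v == psi v).
Proof.
case=> s hs [t ht]; exists (s ++ t) => v w vw.
by rewrite (hs v w) ?(ht v w) // => p ps; apply: vw; rewrite mem_cat ps ?orbT.
Qed.

Lemma finitary_all (T : Type) (s : seq T) (phi : T -> ({mpoly int[n]} -> bool) -> bool) :
  (forall t, finitary (phi t)) -> finitary (fun v => all (phi^~ v) s).
Proof.
move=> phiP; elim: s => [|t s IHs]; first exact: finitary_const.
exact: finitary_and.
Qed.

Lemma finitary_has (T : Type) (s : seq T) (phi : T -> ({mpoly int[n]} -> bool) -> bool) :
  (forall t, finitary (phi t)) -> finitary (fun v => has (phi^~ v) s).
Proof.
move=> phiP; elim: s => [|t s IHs]; first exact: finitary_const.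
exact: finitary_or.
Qed.

End Finitary.

Lemma finitary_comp n m (s : {mpoly int[m]} -> {mpoly int[n]})
    (phi : ({mpoly int[m]} -> bool) -> bool) :
  finitary phi -> finitary (fun v => phi (v \o s)).
Proof.
case=> r hr; exists (map s r) => v w vw; apply: hr => p pr /=.
by apply: vw; apply: map_f.
Qed.

Lemma intr_Fp_neq0 (k : int) p :
  prime p -> k != 0 -> (`|k| < p)%N -> k%:~R != 0 :> 'F_p.
Proof.
move=> p_pr k0 lt_kp.
have absP (m : nat) : (0 < m < p)%N -> m%:R != 0 :> 'F_p.
  case/andP=> m0 lt_mp; rewrite -(dvdn_pcharf (pchar_Fp p_pr)).
  by apply/negP => /(dvdn_leq m0); rewrite leqNgt lt_mp.
case: k k0 lt_kp => m m0 lt_mp; first by apply: absP; rewrite lt0n m0 lt_mp.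
by rewrite NegzE rmorphN oppr_eq0; apply: absP.
Qed.

Lemma dvd_bigprod (R : comNzRingType) (s : seq R) (P : pred R) a :
  a \in s -> P a -> exists b, \prod_(i <- s | P i) i = a * b.
Proof. by move=> a_s Pa; rewrite (big_rem a a_s) Pa; eexists. Qed.

Section Specialize.
Variable n : nat.
Local Notation point := {p : nat & 'rV['F_p]_n}.
Variables (FF : {mpoly int[n]} -> Prop) (B : point -> Prop).
(** Finite satisfiability at arbitrarily large primes; the bound [k] is what forces characteristic
    zero in the limit. *)
Hypothesis B_sat : forall (s : seq {mpoly int[n]}) (k : nat),
  (forall f, f \in s -> FF f) ->
  exists j : point, [/\ B j, prime (tag j), (k <= tag j)%N
                      & forall f, f \in s -> vanish (tagged j) f].

(* The polynomials vanishing at almost all points with respect to an ultrafilter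
   form a prime ideal, and a homomorphism to [algC] killing it is a point over
   [algC]. *)
Lemma specialize (fs : seq {mpoly int[n]}) :
  exists2 y : 'rV[algC]_n, forall f, FF f -> vanish y f
    & exists j : point, [/\ B j, prime (tag j)
                          & {in fs, vanish y =1 vanish (tagged j)}].
Proof.
pose D (sk : seq {mpoly int[n]} * nat) := forall f, f \in sk.1 -> FF f.
pose base (sk : seq {mpoly int[n]} * nat) (j : point) :=
  [/\ B j, prime (tag j), (sk.2 <= tag j)%N
    & forall f, f \in sk.1 -> vanish (tagged j) f].
have base_filter : ProperFilter (filter_from D base).
  apply: filter_from_proper; last by move=> [s k] Ds; apply: (B_sat k Ds).
  apply: filter_from_filter; first by exists ([::], 0%N).
  move=> [s k] [t l] Ds Dt; exists (s ++ t, maxn k l).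
    by move=> f; rewrite mem_cat => /orP[/Ds|/Dt].
  move=> j [Bj pj]; rewrite geq_max => /andP[kj lj] vj.
  by split; split=> // f fs'; apply: vj; rewrite mem_cat fs' ?orbT.
have [U [U_ultra sub_U]] := ultraFilterLemma base_filter.
have UF : ProperFilter U by exact: ultra_proper.
have U_ex (P : point -> Prop) : U P -> exists j, P j by move/filter_ex.
have U_base : U (base ([::], 0%N)) by apply: sub_U; exists ([::], 0%N).
pose I (f : {mpoly int[n]}) := U (fun j : point => vanish (tagged j) f).
have PI : prime_ideal I.
  split.
  - by apply: filterS filterT => j _; apply: vanish0.
  - move=> a b Ia Ib; apply: filterS (filterI Ia Ib) => j [aj bj].
    exact: vanishD.
  - by move=> a b; apply: filterS => j bj; rewrite vanishM bj orbT.
  - by move/U_ex=> [j]; rewrite vanish1.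
  move=> a b Iab.
  have [|Ua] := in_ultra_setVsetC (fun j : point => vanish (tagged j) a) U_ultra.
    by left.
  right; apply: filterS (filterI Iab Ua) => j [abj /negP/negPf aj].
  by rewrite vanishM aj in abj.
have I_int (k : int) : I k%:~R -> k = 0.
  move=> Ik; apply/eqP/negP => /negP k0.
  have : U (base ([::], `|k|.+1%N)) by apply: sub_U; exists ([::], `|k|.+1%N).
  move=> /(filterI Ik) /U_ex[j [kj [_ pj lt_kj _]]].
  by move: kj; rewrite vanish_int; apply/negP/intr_Fp_neq0.
pose nI : pred {mpoly int[n]} := fun f => ~~ `[< I f >].
(* By primality one element outside [I] guards every member of [fs] outside [I]: a homomorphism
   nonzero on the product is nonzero on each factor. *)
pose g := \prod_(f <- fs | nI f) f.
have Ig : ~ I g by case/(prime_ideal_prod PI) => f [_ /asboolPn].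
have [psi psiI psi_g] := specializable_mpoly PI I_int Ig.
pose y := \row_i psi 'X_i.
have yE f : zeval y f = psi f by rewrite [RHS]zeval_unique.
have y_fs f : f \in fs -> vanish y f = `[< I f >].
  move=> f_fs; rewrite /vanish yE; apply/eqP/asboolP => [psi_f|/psiI //].
  apply: contrapT => /asboolPn If; move/eqP: psi_g; apply.
  have [h gE] := @dvd_bigprod _ fs nI f f_fs If.
  by rewrite /g gE rmorphM psi_f mul0r.
exists y => [f FFf|].
  rewrite /vanish yE; apply/eqP/psiI.
  have : U (base ([:: f], 0%N)).
    by apply: sub_U; exists ([:: f], 0%N) => // h; rewrite inE => /eqP ->.
  by apply: filterS => j [_ _ _]; apply; apply: mem_head.
suff /(filterI U_base)/U_ex[j [[Bj pj _ _] yj]] :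
    U (fun j => forall f, f \in fs -> vanish y f = vanish (tagged j) f).
  by exists j.
(* The ultrafilter decides each member of [fs], so the points that agree with y on it form a set of
   [U]; finitely many such sets meet in a set of [U]. *)
elim: fs {g Ig psi_g} y_fs => [|f fs IHfs] y_fs; first exact: filterS filterT.
have Uf : U (fun j => vanish y f = vanish (tagged j) f).
  rewrite y_fs ?mem_head //.
  have [If|If] := in_ultra_setVsetC (fun j : point => vanish (tagged j) f) U_ultra.
    by apply: filterS (If) => j ->; apply/asboolT.
  apply: filterS (If) => j /= /negP/negPf ->; apply/asboolPn => If'.
  by have [j' []] := U_ex _ (filterI If If').
have /IHfs Ufs : forall h, h \in fs -> vanish y h = `[< I h >].
  by move=> h h_fs; apply: y_fs; rewrite inE h_fs orbT.
apply: filterS (filterI Uf Ufs) => j [fj fsj] h.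
by rewrite inE => /orP[/eqP->|/fsj].
Qed.

End Specialize.

(** * Almost all primes, and the transfer principle *)

Definition almost_all_primes (P : nat -> Prop) : Prop :=
  exists k, forall p, prime p -> (k <= p)%N -> P p.

Lemma aap_mono (P Q : nat -> Prop) :
  (forall p, prime p -> P p -> Q p) -> almost_all_primes P -> almost_all_primes Q.
Proof. by move=> PQ [k Pk]; exists k => p pp kp; apply/PQ/Pk. Qed.

Lemma aap_true (P : nat -> Prop) : (forall p, prime p -> P p) -> almost_all_primes P.
Proof. by move=> allP; exists 0%N => p /allP. Qed.

Lemma aap_and (P Q : nat -> Prop) :
  almost_all_primes P -> almost_all_primes Q ->
  almost_all_primes (fun p => P p /\ Q p).
Proof.
move=> [k Pk] [l Ql]; exists (maxn k l) => p pp; rewrite geq_max => /andP[kp lp].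
by split; [apply: Pk | apply: Ql].
Qed.

Lemma aap_all (T : eqType) (s : seq T) (P : T -> nat -> Prop) :
  (forall t, t \in s -> almost_all_primes (P t)) ->
  almost_all_primes (fun p => forall t, t \in s -> P t p).
Proof.
elim: s => [|t s IHs] Ps; first by apply: aap_true.
have Pt := Ps t (mem_head t s).
have /IHs Ps' : forall u, u \in s -> almost_all_primes (P u).
  by move=> u us; apply: Ps; rewrite inE us orbT.
apply: aap_mono (aap_and Pt Ps') => p _ [Ptp Pp] u.
by rewrite inE => /orP[/eqP->|/Pp].
Qed.

(** If no finite part of [FF] worked, each would admit counterexamples to [phi] at arbitrarily large
    primes, and [specialize] would turn these into a counterexample over [algC]. *)
Lemma transfer_compact n (FF : {mpoly int[n]} -> Prop) phi :
  finitary phi ->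
  (forall y : 'rV[algC]_n, (forall f, FF f -> vanish y f) -> phi (vanish y)) ->
  exists2 s : seq {mpoly int[n]}, forall f, f \in s -> FF f &
    almost_all_primes (fun p => forall x : 'rV['F_p]_n,
      (forall f, f \in s -> vanish x f) -> phi (vanish x)).
Proof.
move=> [fs phiP] phiC; apply: contrapT => no_s.
have [|y yFF [[p x] [/= phix _ yx]]] :=
    @specialize n FF (fun j => ~ phi (vanish (tagged j))) _ fs; last first.
  by apply: phix; rewrite -(phiP _ _ yx); apply: phiC.
move=> s k sFF; apply: contrapT => no_j; apply: no_s; exists s => //.
exists k => p pp kp x xs; apply: contrapT => phix.
by apply: no_j; exists (Tagged (fun p => 'rV['F_p]_n) x).
Qed.

Lemma transfer n phi :
  finitary phi -> (forall y : 'rV[algC]_n, phi (vanish y)) ->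
  almost_all_primes (fun p => forall x : 'rV['F_p]_n, phi (vanish x)).
Proof.
move=> phi_fin phiC.
have [|s s0] := @transfer_compact n (fun _ => False) phi phi_fin _.
  by move=> y _; apply: phiC.
by apply: aap_mono => p _ H x; apply: H => f /s0.
Qed.

(** A common factor [D] for the whole family preserves the ratios of its members, so the integral
    tuple gives the same point in homogeneous coordinates. *)
Lemma clear_denominators n (T : finType) (P : T -> {mpoly rat[n]}) :
  exists (D : int) (Q : T -> {mpoly int[n]}),
    D != 0 /\ forall i, map_mpoly intr (Q i) = D%:~R *: P i.
Proof.
pose D : int := \prod_i \prod_(m <- msupp (P i)) denq (P i)@_m.
have DP i m : D%:~R * (P i)@_m \is a Num.int.
  have [mP|] := boolP (m \in msupp (P i)); last first.
    by move/memN_msupp_eq0->; rewrite mulr0 rpred0.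
  have [k ->] : exists k, D = k * denq (P i)@_m.
    rewrite /D (bigD1 i) //= (big_rem m) //= -mulrA mulrC.
    by eexists.
  by rewrite rmorphM /= -mulrA [_ * (P i)@_m]mulrC -numqE rpredM ?rpred_int.
pose Q i := \sum_(m <- msupp (P i)) (numq (D%:~R * (P i)@_m)) *: 'X_[m] : {mpoly int[n]}.
exists D, Q; split.
  apply/prodf_neq0 => i _; rewrite prodf_seq_neq0; apply/allP => m _.
  exact: denq_neq0.
move=> i; rewrite [in RHS](mpolyE (P i)) scaler_sumr rmorph_sum; apply: eq_bigr => m _.
rewrite /= map_mpolyZ map_mpolyX scalerA; congr (_ *: _).
exact: numqK.
Qed.

(** * Loci of varieties *)

Lemma zpoly_subproof n (p : {mpoly rat[n]}) :
  exists Q : {mpoly int[n]}, exists2 D : int, D != 0 &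
    map_mpoly intr Q = D%:~R *: p.
Proof.
have [D [Q [D0 QP]]] := clear_denominators (fun _ : unit => p).
by exists (Q tt), D.
Qed.

(** The choice of the integral multiple affects the zeros modulo p for finitely many p only. *)
Definition zpoly n (p : {mpoly rat[n]}) : {mpoly int[n]} :=
  sval (cid (zpoly_subproof p)).

Lemma zpolyP n (p : {mpoly rat[n]}) :
  exists2 D : int, D != 0 & map_mpoly intr (zpoly p) = D%:~R *: p.
Proof. exact: svalP (cid (zpoly_subproof p)). Qed.

Section ClearDenominators.
Variables (n : nat) (p : {mpoly rat[n]}) (q : {mpoly int[n]}) (D : int).
Hypotheses (D0 : D != 0) (qE : map_mpoly intr q = D%:~R *: p).

Lemma zeval_clear (y : 'rV[algC]_n) : zeval y q = D%:~R * peval p y.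
Proof.
have -> : zeval y q = peval (map_mpoly intr q) y.
  rewrite /peval /=; congr (meval _ _); apply/mpolyP => m.
  by rewrite !mcoeff_map_mpoly /=; apply/esym/ratr_int.
by rewrite qE /peval map_mpolyZ mevalZ; congr (_ * _); apply: ratr_int.
Qed.

Lemma vanish_clear (y : 'rV[algC]_n) : vanish y q = (peval p y == 0).
Proof. by rewrite /vanish zeval_clear mulf_eq0 intr_eq0 (negPf D0). Qed.

Lemma homog_clear d : p \is d.-homog -> q \is d.-homog.
Proof.
move=> /dhomogP hp; apply/dhomogP => m mq; apply: hp.
have : (map_mpoly intr q)@_m != 0 :> rat.
  by rewrite mcoeff_map_mpoly /= intr_eq0 -mcoeff_msupp.
by rewrite qE mcoeffZ mulf_eq0 negb_or -mcoeff_msupp => /andP[].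
Qed.

End ClearDenominators.

Lemma vanish_zpoly n (p : {mpoly rat[n]}) (y : 'rV[algC]_n) :
  vanish y (zpoly p) = (peval p y == 0).
Proof. by have [D D0 /(vanish_clear D0)] := zpolyP p. Qed.

Lemma zpoly_homog n (p : hpoly n) : exists d, zpoly (val p) \is d.-homog.
Proof.
have /homogP[d hd] := valP p; exists d.
by have [D _ /homog_clear] := zpolyP (val p); apply.
Qed.

Lemma zeval_scale (R : comNzRingType) n d (p : {mpoly int[n]}) c (x : 'rV[R]_n) :
  p \is d.-homog -> zeval (c *: x) p = c ^+ d * zeval x p.
Proof.
move=> /dhomogP hp; rewrite !zevalE mulr_sumr !big_seq.
apply: eq_bigr => m /hp dm.
have -> : d = (\sum_i m i)%N by rewrite -dm; apply: mdegE.
rewrite mulrCA; congr (_ * _); rewrite -prodrXr -big_split /=.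
by apply: eq_bigr => i _; rewrite mxE exprMn.
Qed.

Lemma vanish_scale (F : fieldType) n d (p : {mpoly int[n]}) c (x : 'rV[F]_n) :
  p \is d.-homog -> c != 0 -> vanish (c *: x) p = vanish x p.
Proof.
move=> hp c0; rewrite /vanish (zeval_scale _ _ hp) mulf_eq0 expf_eq0.
by rewrite (negPf c0) andbF.
Qed.

(* Membership in a locally closed subset, as a quantifier-free formula. *)
Definition locus N (X : locally_closed N) (v : {mpoly int[N]} -> bool) : bool :=
  [&& has (fun i => ~~ v 'X_i) (enum 'I_N), all (fun p => v (zpoly (val p))) X.1
    & has (fun q => ~~ v (zpoly (val q))) X.2].

Lemma finitary_locus N (X : locally_closed N) : finitary (locus X).
Proof.
apply: finitary_and; last apply: finitary_and.
- by apply: finitary_has => i; apply/finitary_neg/finitary_atom.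
- by apply: finitary_all => p; apply: finitary_atom.
by apply: finitary_has => p; apply/finitary_neg/finitary_atom.
Qed.

Lemma has_coord (F : fieldType) N (x : 'rV[F]_N) :
  has (fun i => ~~ vanish x 'X_i) (enum 'I_N) = (x != 0).
Proof.
apply/hasP/idP => [[i _]|/eqP x0].
  by rewrite vanishX; apply: contra => /eqP ->; rewrite mxE.
apply: contrapT => /hasP /hasPn h; apply: x0; apply/rowP => i.
have := h i; rewrite mem_enum => /(_ isT).
by rewrite vanishX mxE negbK => /eqP.
Qed.

Lemma locusP N (X : locally_closed N) (y : 'rV[algC]_N) :
  reflect (in_locus X y) (locus X (vanish y)).
Proof.
rewrite /locus has_coord; apply: (iffP and3P) => -[y0 X1 X2]; split=> //.
- by move=> p /(allP X1); rewrite vanish_zpoly => /eqP.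
- by have /hasP[q qX] := X2; rewrite vanish_zpoly; exists q.
- by apply/allP => p /X1; rewrite vanish_zpoly => ->.
by have [q qX q0] := X2; apply/hasP; exists q; rewrite ?vanish_zpoly.
Qed.

Lemma locus_neq0 N (X : locally_closed N) (F : fieldType) (x : 'rV[F]_N) :
  locus X (vanish x) -> x != 0.
Proof. by rewrite /locus has_coord => /and3P[]. Qed.

Lemma locus_scale N (X : locally_closed N) (F : fieldType) c (x : 'rV[F]_N) :
  c != 0 -> locus X (vanish (c *: x)) = locus X (vanish x).
Proof.
move=> c0; rewrite /locus !has_coord scaler_eq0 (negPf c0) /=.
congr [&& _, _ & _]; [apply: eq_all | apply: eq_has] => p.
  by have [d /vanish_scale->] := zpoly_homog p.
by have [d /vanish_scale->] := zpoly_homog p.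
Qed.

Definition cone N (X : locally_closed N) p : {set 'rV['F_p]_N} :=
  [set x : 'rV['F_p]_N | locus X (vanish x)].

Lemma cone_scale N (X : locally_closed N) p c (x : 'rV['F_p]_N) :
  c != 0 -> (c *: x \in cone X p) = (x \in cone X p).
Proof. by move=> c0; rewrite !inE locus_scale. Qed.

(** * Point counts modulo p *)

Lemma powersum_Fp p k : prime p -> (k < p.-1)%N -> \sum_(a : 'F_p) a ^+ k = 0.
Proof.
move=> pp lt_k; case: k lt_k => [_|k lt_k].
  rewrite (eq_bigr (fun=> 1)) ?sumr_const ?card_Fp //.
  exact: pchar_Fp_0.
(* The exponent is less than p - 1, so its power map is not constantly 1 on the nonzero elements.
   Multiplication by [b] permutes the field and multiplies the sum by a factor other than 1. *)
have [b b0 bk] : exists2 b : 'F_p, b != 0 & b ^+ k.+1 != 1.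
  apply: contrapT => no_b.
  pose f : {poly 'F_p} := 'X^(k.+1) - 1%:P.
  have f0 : f != 0 by rewrite -size_poly_eq0 size_XnsubC.
  have := @max_poly_roots _ f (enum [pred b : 'F_p | b != 0]) f0.
  rewrite enum_uniq size_XnsubC // -cardE cardC1 card_Fp // => H.
  suff : (p.-1 < k.+2)%N by rewrite ltnS leqNgt lt_k.
  apply: H => //; apply/allP => b; rewrite mem_enum inE => b0.
  rewrite rootE !hornerE subr_eq0; apply/negP => /negP bk.
  by apply: no_b; exists b.
have : (b ^+ k.+1 - 1) * (\sum_(a : 'F_p) a ^+ k.+1) = 0.
  rewrite mulrBl mul1r mulr_sumr [X in _ - X](reindex_inj (mulfI b0)) /=.
  by rewrite -sumrB big1 // => a _; rewrite exprMn subrr.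
by move/eqP; rewrite mulf_eq0 subr_eq0 (negPf bk) => /eqP.
Qed.

Lemma Fp_expr_predp p (a : 'F_p) : prime p -> a ^+ p.-1 = (a != 0)%:R.
Proof.
move=> pp; have p1 : (0 < p.-1)%N by case: p pp a => [|[|]].
have [->|a0] := eqVneq a 0; first by rewrite expr0n gtn_eqF.
apply: (mulfI a0); rewrite mulr1 -exprS prednK ?prime_gt0 //.
by have := expf_card a; rewrite card_Fp.
Qed.

Lemma sum_expr_predp p : prime p -> \sum_(a : 'F_p) a ^+ p.-1 = -1.
Proof.
move=> pp; rewrite (bigD1 0) //= Fp_expr_predp // eqxx add0r.
rewrite (eq_bigr (fun=> 1)) => [|a a0]; last by rewrite Fp_expr_predp // a0.
apply/eqP; rewrite sumr_const cardC1 card_Fp // -subr_eq0 opprK natr1.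
by rewrite prednK ?prime_gt0 // pchar_Fp_0.
Qed.

Lemma monomial_sum p n (m : 'I_n -> nat) :
  \sum_(x : 'rV['F_p]_n) \prod_i x 0 i ^+ m i = \prod_i \sum_(a : 'F_p) a ^+ m i.
Proof.
rewrite bigA_distr_bigA (reindex (fun f : {ffun 'I_n -> 'F_p} => \row_i f i)) /=.
  by apply: eq_bigr => f _; apply: eq_bigr => i _; rewrite mxE.
exists (fun x : 'rV_n => [ffun i => x 0 i]) => [f _|x _].
  by apply/ffunP => i; rewrite ffunE mxE.
by apply/rowP => i; rewrite mxE ffunE.
Qed.

Lemma card_nonvanish p n (f : {mpoly int[n]}) : prime p ->
  #|[set x : 'rV['F_p]_n | ~~ vanish x f]|%:R
    = \sum_(x : 'rV['F_p]_n) zeval x f ^+ p.-1.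
Proof.
move=> pp; rewrite -sumr_const big_mkcond /=.
by apply: eq_bigr => x _; rewrite inE Fp_expr_predp // /vanish; case: ifP.
Qed.

Lemma card_nonvanish_prodX p n : prime p ->
  #|[set x : 'rV['F_p]_n | ~~ vanish x (\prod_i 'X_i)]|%:R = (-1) ^+ n :> 'F_p.
Proof.
move=> pp; rewrite card_nonvanish //.
transitivity (\sum_(x : 'rV['F_p]_n) \prod_i x 0 i ^+ p.-1).
  apply: eq_bigr => x _; rewrite rmorph_prod -prodrXl.
  by apply: eq_bigr => i _; rewrite zevalX.
rewrite monomial_sum (eq_bigr (fun=> -1)) ?prodr_const ?card_ord // => i _.
exact: sum_expr_predp.
Qed.

(* Chevalley-Warning. *)
Lemma card_nonvanish_low_degree p n d (f : {mpoly int[n]}) :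
  prime p -> f \is d.-homog -> (d < n)%N ->
  #|[set x : 'rV['F_p]_n | ~~ vanish x f]|%:R = 0 :> 'F_p.
Proof.
move=> pp hf lt_dn; rewrite card_nonvanish //.
have /dhomogP hfp := dhomogMn p.-1 hf; set g := f ^+ p.-1 in hfp.
transitivity (\sum_(x : 'rV['F_p]_n) \sum_(m <- msupp g)
                 (g@_m)%:~R * \prod_i x 0 i ^+ m i).
  by apply: eq_bigr => x _; rewrite -rmorphXn zevalE.
rewrite exchange_big big_seq big1 // => m /hfp dm; rewrite -mulr_sumr monomial_sum.
(* The exponents sum to d (p - 1) < n (p - 1), so one of them is below p - 1, and its power sum
   vanishes. *)
suff [i lt_mi] : exists i, (m i < p.-1)%N.
  by rewrite (bigD1 i) //= powersum_Fp // mul0r mulr0.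
apply: contrapT => /forallNP ge_m.
have : (\sum_i m i = d * p.-1)%N by rewrite -dm; apply/esym/mdegE.
suff : (n * p.-1 <= \sum_i m i)%N.
  have p1 : (0 < p.-1)%N by case: p pp {hf hfp g dm ge_m lt_dn m} => [|[|]].
  by move=> + e; rewrite e leq_pmul2r // leqNgt lt_dn.
rewrite -[n in (n * _)%N]card_ord -sum_nat_const; apply: leq_sum => i _.
by rewrite leqNgt; apply/negP/ge_m.
Qed.

(** * The point count of a variety *)

(* Each point of [X] over [F_p] has [p - 1 = -1] vectors of homogeneous
   coordinates. *)
Definition point_count N (X : locally_closed N) p : 'F_p := - #|cone X p|%:R.

Lemma point_count_scissor N (X Y U : locally_closed N) :
  closed_in Y X -> is_difference U X Y ->
  almost_all_primes (fun p => point_count X p = point_count U p + point_count Y p).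
Proof.
move=> [s YX] UXY.
have fin : finitary (fun v => (locus Y v ==> locus X v) &&
                        (locus U v == locus X v && ~~ locus Y v)).
  have [fX fY fU] := And3 (finitary_locus X) (finitary_locus Y) (finitary_locus U).
  apply: finitary_and; first exact: finitary_imply.
  by apply: finitary_eqb => //; apply: finitary_and => //; apply: finitary_neg.
apply: aap_mono (transfer fin _) => [p _ h|y].
  rewrite /point_count -opprD -natrD; congr (- _%:R).
  rewrite -(cardsID (cone Y p) (cone X p)) addnC; congr addn; apply: eq_card.
    move=> x; rewrite !inE; have /andP[_ /eqP->] := h x.
    by rewrite andbC.
  move=> x; rewrite !inE; have /andP[/implyP YXx _] := h x.
  by case: (locus Y _) YXx => [->|_]; rewrite ?andbF.
apply/andP; split; first by apply/implyP => /locusP/YX[/locusP].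
apply/eqP; apply/idP/idP => [/locusP/UXY[/locusP-> nY]|/andP[/locusP Xy nY]].
  by apply/negP => /locusP.
by apply/locusP/UXY; split=> // /locusP; apply/negP.
Qed.

Lemma cone_nonvanish N (X : locally_closed N) f :
  (forall y : 'rV[algC]_N, locus X (vanish y) = ~~ vanish y f) ->
  almost_all_primes (fun p => cone X p = [set x | ~~ vanish x f]).
Proof.
move=> Xf; apply: (@aap_mono (fun p => forall x : 'rV['F_p]_N,
                                locus X (vanish x) == ~~ vanish x f)).
  by move=> p _ h; apply/setP => x; rewrite !inE; apply/eqP/h.
apply: (@transfer N (fun v => locus X v == ~~ v f)) => [|y]; last by rewrite Xf.
by apply: finitary_eqb; [apply: finitary_locus|apply/finitary_neg/finitary_atom].
Qed.

Lemma locus_open N (q : hpoly N) (y : 'rV[algC]_N) :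
  (peval (val q) y != 0 -> y != 0) ->
  locus ([::], [:: q]) (vanish y) = (peval (val q) y != 0).
Proof.
rewrite /locus has_coord /= orbF vanish_zpoly.
by case: eqP => _ h; rewrite ?andbF //= h.
Qed.

Lemma pevalX n (y : 'rV[algC]_n) i : peval 'X_i y = y 0 i.
Proof. by rewrite /peval map_mpolyX mevalXU. Qed.

Lemma locus_affine_space n (y : 'rV[algC]_n.+1) :
  locus (projT2 (affine_space n)) (vanish y) = (y 0 ord0 != 0).
Proof.
rewrite locus_open /= pevalX //.
by apply: contra => /eqP ->; rewrite mxE.
Qed.

Lemma point_count_point :
  almost_all_primes (fun p => point_count (projT2 (affine_space 0)) p = 1).
Proof.
have : forall y : 'rV[algC]_1, locus (projT2 (affine_space 0)) (vanish y)
                                 = ~~ vanish y (\prod_i 'X_i).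
  by move=> y; rewrite locus_affine_space big_ord1 vanishX.
move/cone_nonvanish; apply: aap_mono => p pp e.
by rewrite /point_count e card_nonvanish_prodX // expr1 opprK.
Qed.

Lemma point_count_line :
  almost_all_primes (fun p => point_count (projT2 (affine_space 1)) p = 0).
Proof.
have : forall y : 'rV[algC]_2, locus (projT2 (affine_space 1)) (vanish y)
                                 = ~~ vanish y 'X_ord0.
  by move=> y; rewrite locus_affine_space vanishX.
move/cone_nonvanish; apply: aap_mono => p pp e.
rewrite /point_count e (@card_nonvanish_low_degree p 2 1) ?oppr0 //.
by rewrite dhomogX /= mdeg1.
Qed.

(** * Invariance under isomorphism *)

Section Substitution.
Variables (M N : nat) (Q : {ffun 'I_M -> {mpoly int[N]}}).

Definition zmap (R : comNzRingType) (x : 'rV[R]_N) : 'rV[R]_M :=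
  \row_i zeval x (Q i).

Definition subst (h : {mpoly int[M]}) : {mpoly int[N]} := zeval (\row_i Q i) h.

Lemma zeval_subst (R : comNzRingType) (x : 'rV[R]_N) h :
  zeval x (subst h) = zeval (zmap x) h.
Proof.
rewrite /subst rmorph_zeval; set z := map_mx _ _.
by suff -> : z = zmap x by []; apply/rowP => i; rewrite !mxE.
Qed.

Lemma vanish_subst (F : fieldType) (x : 'rV[F]_N) :
  vanish (zmap x) =1 vanish x \o subst.
Proof. by move=> h; rewrite /= /vanish zeval_subst. Qed.

Lemma has_zmap (F : fieldType) (x : 'rV[F]_N) :
  has (fun i => ~~ vanish x (Q i)) (enum 'I_M) = (zmap x != 0).
Proof.
rewrite -has_coord; apply: eq_has => i.
by rewrite [in RHS]/vanish zevalX mxE.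
Qed.

Lemma zmap_scale (R : comNzRingType) d c (x : 'rV[R]_N) :
  (forall i, Q i \is d.-homog) -> zmap (c *: x) = c ^+ d *: zmap x.
Proof. by move=> hQ; apply/rowP => i; rewrite !mxE (zeval_scale _ _ (hQ i)). Qed.

End Substitution.

Lemma eq_locus N (X : locally_closed N) v w : v =1 w -> locus X v = locus X w.
Proof. by have [s h] := finitary_locus X => vw; apply: h => p _. Qed.

Lemma vanish_minor (F : fieldType) n (x : 'rV[F]_n) p q (a b : F) i j :
  zeval x p = a -> zeval x q = b ->
  vanish x (p * 'X_j - q * 'X_i) = (a * x 0 j == b * x 0 i).
Proof. by move=> <- <-; rewrite /vanish rmorphB !rmorphM !zevalX subr_eq0. Qed.

Section LeadingCoordinate.
Variables (F : fieldType) (n : nat).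
Implicit Types (x z : 'rV[F]_n).

(** Homogeneous of degree one and nonzero off 0, it fixes the scalar left free by maps that are
    defined only up to proportionality. *)
Definition lead x : F := if [pick i | x 0 i != 0] is Some i then x 0 i else 0.

Lemma lead_eq0 x : (lead x == 0) = (x == 0).
Proof.
rewrite /lead; case: pickP => [i xi|x0].
  by rewrite (negPf xi); apply/esym; apply: contraNF xi => /eqP ->; rewrite mxE.
rewrite eqxx; apply/esym/eqP/rowP => i.
by apply/eqP; rewrite mxE; have /negbFE := x0 i.
Qed.

Lemma lead_scale c x : lead (c *: x) = c * lead x.
Proof.
have [->|c0] := eqVneq c 0.
  by rewrite scale0r mul0r; apply/eqP; rewrite lead_eq0.
rewrite /lead; have -> : [pick i | (c *: x) 0 i != 0] = [pick i | x 0 i != 0].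
  by apply: eq_pick => i; rewrite /= mxE mulf_eq0 (negPf c0).
by case: pickP => [i _|_]; rewrite ?mxE ?mulr0.
Qed.

Lemma proportional x z : x != 0 ->
  (forall i j, z 0 i * x 0 j = z 0 j * x 0 i) -> exists c, z = c *: x.
Proof.
rewrite -lead_eq0 /lead; case: pickP => [j xj _ h|_]; last by rewrite eqxx.
exists (z 0 j / x 0 j); apply/rowP => i.
by rewrite mxE mulrAC -h mulfK.
Qed.

End LeadingCoordinate.

Definition chart N M (X : locally_closed N) (f : 'rV[algC]_N -> 'rV[algC]_M)
    (Q : {ffun 'I_M -> {mpoly int[N]}}) : Prop :=
  (exists d, forall i, Q i \is d.-homog) /\
  forall y : 'rV[algC]_N, locus X (vanish y) -> zmap Q y != 0 -> proj_eq (f y) (zmap Q y).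

Lemma regular_map_chart N M (X : locally_closed N) (Y : locally_closed M) f
    (y : 'rV[algC]_N) :
  regular_map X Y f -> locus X (vanish y) ->
  exists2 Q, chart X f Q & zmap Q y != 0.
Proof.
move=> f_reg Xy; have [_ [d [P [homP Py fP]]]] := f_reg y (elimT (locusP X y) Xy).
have [D [Q0 [D0 Q0P]]] := clear_denominators P.
pose Q := [ffun i => Q0 i].
have QE z : zmap Q z = D%:~R *: \row_i peval (P i) z.
  by apply/rowP => i; rewrite !mxE ffunE (zeval_clear (Q0P i)).
have D0' : D%:~R != 0 :> algC by rewrite intr_eq0.
exists Q; last by rewrite QE scaler_eq0 (negPf D0').
split; first by exists d => i; rewrite ffunE (homog_clear (Q0P i)).
move=> z /locusP Xz; rewrite QE scaler_eq0 (negPf D0') /= => Pz.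
have [c c0 ->] := fP z Xz Pz; exists (D%:~R * c); last by rewrite scalerA.
by rewrite mulf_neq0.
Qed.

(** [FF] consists of all entries of all charts; they have no common zero on [X] over [algC].
    Compactness leaves finitely many entries, and one chart for each of them covers [X] modulo
    almost all primes. *)
Lemma finite_chart_cover N M (X : locally_closed N) (Y : locally_closed M) f :
  regular_map X Y f ->
  exists2 cs : seq {ffun 'I_M -> {mpoly int[N]}},
    forall Q, Q \in cs -> chart X f Q &
    almost_all_primes (fun p => forall x : 'rV['F_p]_N,
      locus X (vanish x) -> exists2 Q, Q \in cs & zmap Q x != 0).
Proof.
move=> f_reg; pose FF h := exists2 Q, chart X f Q & exists i, h = Q i.
have [|y yFF|s sFF X_s] := @transfer_compact N FF (fun v => ~~ locus X v) _ _.
- exact/finitary_neg/finitary_locus.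
- apply/negP => Xy; have [Q Qf] := regular_map_chart f_reg Xy.
  rewrite -has_zmap => /hasP[i _ /negP]; apply; apply: yFF.
  by exists Q => //; exists i.
have [cs csf s_cs] : exists2 cs : seq {ffun 'I_M -> {mpoly int[N]}},
    forall Q, Q \in cs -> chart X f Q &
    forall h, h \in s -> exists2 Q : {ffun 'I_M -> {mpoly int[N]}},
                           Q \in cs & exists i, h = Q i.
  elim: s sFF {X_s} => [|h s IHs] sFF; first by exists [::].
  have [Q Qf [i hQ]] := sFF h (mem_head h s).
  have [|cs csf s_cs] := IHs.
    by move=> k ks; apply: sFF; rewrite inE ks orbT.
  exists (Q :: cs) => [R|k]; first by rewrite inE => /orP[/eqP->|/csf].
  rewrite inE => /orP[/eqP->|/s_cs[R Rcs Rk]].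
    by exists Q; [apply: mem_head | exists i].
  by exists R; rewrite // inE Rcs orbT.
exists cs => //; apply: aap_mono X_s => p _ h x Xx.
apply: contrapT => no_Q; suff /h : forall k, k \in s -> vanish x k by rewrite Xx.
move=> k /s_cs[Q Qcs [i ->]].
apply: contrapT => Qi; apply: no_Q; exists Q => //.
by rewrite -has_zmap; apply/hasP; exists i; rewrite ?mem_enum //; apply/negP.
Qed.

Section ChartTransfer.
Variables (N M : nat) (X : locally_closed N) (Y : locally_closed M).
Variables (f : 'rV[algC]_N -> 'rV[algC]_M) (g : 'rV[algC]_M -> 'rV[algC]_N).
Hypotheses (f_reg : regular_map X Y f) (g_reg : regular_map Y X g).
Hypothesis gf : forall x, in_locus X x -> proj_eq (g (f x)) x.
Variables (Q : {ffun 'I_M -> {mpoly int[N]}}) (R : {ffun 'I_N -> {mpoly int[M]}}).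
Hypotheses (Qf : chart X f Q) (Rg : chart Y g R).

Let locus_chart (y : 'rV[algC]_N) : locus X (vanish y) -> zmap Q y != 0 ->
  locus Y (vanish (zmap Q y)).
Proof.
move=> Xy Qy; have [_ /(_ y Xy Qy)[c c0 ->]] := Qf.
rewrite locus_scale //; apply/locusP.
by have [] := f_reg (elimT (locusP X y) Xy).
Qed.

Lemma aap_chart : almost_all_primes (fun p => forall x : 'rV['F_p]_N,
  locus X (vanish x) -> zmap Q x != 0 -> locus Y (vanish (zmap Q x))).
Proof.
pose phi v := locus X v ==> (has (fun i => ~~ v (Q i)) (enum 'I_M)
                              ==> locus Y (v \o subst Q)).
have fin : finitary phi.
  apply: finitary_imply; first exact: finitary_locus.
  apply: finitary_imply; last exact/finitary_comp/finitary_locus.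
  by apply: finitary_has => i; apply/finitary_neg/finitary_atom.
have phiE (F : fieldType) (x : 'rV[F]_N) : phi (vanish x) =
    (locus X (vanish x) ==> ((zmap Q x != 0) ==> locus Y (vanish (zmap Q x)))).
  by rewrite /phi has_zmap -(eq_locus Y (vanish_subst Q x)).
apply: aap_mono (transfer fin _) => [p _ h x Xx Qx|y].
  by have := h x; rewrite phiE Xx Qx.
by rewrite phiE; apply/implyP => Xy; apply/implyP => Qy; apply: locus_chart.
Qed.

(** What is transferred is the vanishing of the 2 x 2 minors of the pair of vectors; [proportional]
    then recovers the scalar modulo p. *)
Lemma aap_chart_inv : almost_all_primes (fun p => forall x : 'rV['F_p]_N,
  locus X (vanish x) -> zmap Q x != 0 -> zmap R (zmap Q x) != 0 ->
  exists c, zmap R (zmap Q x) = c *: x).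
Proof.
pose minor i j := subst Q (R i) * 'X_j - subst Q (R j) * 'X_i.
pose phi v := locus X v ==> (has (fun i => ~~ v (Q i)) (enum 'I_M) ==>
  (has (fun i => ~~ v (subst Q (R i))) (enum 'I_N) ==>
     all (fun i => all (fun j => v (minor i j)) (enum 'I_N)) (enum 'I_N))).
have fin : finitary phi.
  apply: finitary_imply; first exact: finitary_locus.
  apply: finitary_imply.
    by apply: finitary_has => i; apply/finitary_neg/finitary_atom.
  apply: finitary_imply.
    by apply: finitary_has => i; apply/finitary_neg/finitary_atom.
  by apply: finitary_all => i; apply: finitary_all => j; apply: finitary_atom.
have has_R (F : fieldType) (x : 'rV[F]_N) :
    has (fun i => ~~ vanish x (subst Q (R i))) (enum 'I_N)
      = (zmap R (zmap Q x) != 0).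
  rewrite -has_zmap; apply: eq_has => i; congr negb.
  by rewrite vanish_subst.
have minorE (F : fieldType) (x : 'rV[F]_N) i j : vanish x (minor i j)
    = (zmap R (zmap Q x) 0 i * x 0 j == zmap R (zmap Q x) 0 j * x 0 i).
  have subE k : zeval x (subst Q (R k)) = zmap R (zmap Q x) 0 k.
    by rewrite zeval_subst mxE.
  exact: vanish_minor.
apply: aap_mono (transfer fin _) => [p _ h x Xx Qx Rx|y].
  have := h x; rewrite /phi has_zmap has_R Xx Qx Rx /= => /allP hx.
  apply: proportional => [|i j]; first exact: locus_neq0 Xx.
  by apply/eqP; rewrite -minorE; apply: (allP (hx i _)); rewrite mem_enum.
rewrite /phi has_zmap has_R.
apply/implyP => Xy; apply/implyP => Qy; apply/implyP => Ry.
have [[d hR] gR] := Rg.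
have [_ /(_ y Xy Qy)[c c0 Qc]] := Qf.
have Yf : locus Y (vanish (f y)).
  by apply/locusP; have [] := f_reg (elimT (locusP X y) Xy).
(* [Q] gives f y only up to a scalar. Homogeneity of [R] pulls the scalar out, so [R] is nonzero at
   f y as well and represents g there. *)
have Rc : zmap R (zmap Q y) = c ^+ d *: zmap R (f y) by rewrite Qc (zmap_scale _ _ hR).
have [|a _ ga] := gR (f y) Yf.
  by move: Ry; rewrite Rc scaler_eq0 => /norP[].
have [b b0 yb] := gf (elimT (locusP X y) Xy).
have gE : g (f y) = b^-1 *: y by rewrite [X in _ = _ *: X]yb scalerA mulVf ?scale1r.
apply/allP => i _; apply/allP => j _; rewrite minorE Rc ga gE !scalerA.
by apply/eqP; rewrite !mxE; ring.
Qed.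

End ChartTransfer.

Lemma find_mem (T : eqType) (x0 : T) (P : pred T) s : has P s ->
  nth x0 s (find P s) \in s /\ P (nth x0 s (find P s)).
Proof. by move=> hP; split; [rewrite mem_nth // -has_find | apply: nth_find]. Qed.

(** Each x goes to its value under the first chart that is nonzero at x, rescaled to have the same
    [lead] as x. Charts need not agree on scalars: the way back gives a multiple of x with the same
    [lead], which is x, so the map is injective. *)
Lemma cone_le N M (X : locally_closed N) (Y : locally_closed M) f g :
  regular_map X Y f -> regular_map Y X g ->
  (forall x, in_locus X x -> proj_eq (g (f x)) x) ->
  almost_all_primes (fun p => #|cone X p| <= #|cone Y p|)%N.
Proof.
move=> f_reg g_reg gf.
have [cs csf X_cs] := finite_chart_cover f_reg.
have [ds dsg Y_ds] := finite_chart_cover g_reg.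
have cs_Y := aap_all (fun Q Qcs => aap_chart f_reg (csf Q Qcs)).
have ds_cs := aap_all (fun Q Qcs => aap_all (fun R Rds =>
  aap_chart_inv f_reg gf (csf Q Qcs) (dsg R Rds))).
apply: aap_mono (aap_and (aap_and X_cs Y_ds) (aap_and cs_Y ds_cs)).
move=> p pp [[{}X_cs {}Y_ds] [{}cs_Y {}ds_cs]].
(* The default 0 is never reached on a cone, where some chart of the list is nonzero. *)
pose eval m n (ss : seq {ffun 'I_m -> {mpoly int[n]}}) (x : 'rV['F_p]_n) :=
  let w := zmap (nth [ffun=> 0] ss (find (fun Q => zmap Q x != 0) ss)) x in
  (lead x / lead w) *: w.
have evalP m n (ss : seq {ffun 'I_m -> {mpoly int[n]}}) (x : 'rV['F_p]_n) :
    x != 0 -> (exists2 Q, Q \in ss & zmap Q x != 0) ->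
    exists Q, [/\ Q \in ss, zmap Q x != 0 & eval m n ss x = (lead x / lead (zmap Q x)) *: zmap Q x].
  move=> x0 [Q Qss Qx]; exists (nth [ffun=> 0] ss (find (fun Q => zmap Q x != 0) ss)).
  have ss_x : has (fun Q => zmap Q x != 0) ss by apply/hasP; exists Q.
  have [Qin Qx'] := find_mem [ffun=> 0] ss_x.
  by split; [exact: Qin | exact: Qx' | reflexivity].
have lead_div m n (x : 'rV['F_p]_n) (w : 'rV['F_p]_m) :
    x != 0 -> w != 0 -> lead x / lead w != 0.
  by move=> x0 w0; rewrite mulf_neq0 // ?invr_eq0 lead_eq0.
have FP x : x \in cone X p -> eval M N cs x \in cone Y p.
  rewrite !inE => Xx; have x0 := locus_neq0 Xx.
  have [Q [Qcs Qx ->]] := evalP M N cs x x0 (X_cs x Xx).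
  by rewrite locus_scale; [apply: cs_Y | apply: lead_div].
have FK : {in cone X p, cancel (eval M N cs) (eval N M ds)}.
  move=> x Xx; have := FP x Xx; rewrite !inE in Xx *.
  have x0 := locus_neq0 Xx; have [Q [Qcs Qx ->]] := evalP M N cs x x0 (X_cs x Xx).
  set w := zmap Q x in Qx *; set c := lead x / lead w => Yw.
  have c0 : c != 0 by apply: lead_div.
  have cw : lead (c *: w) = lead x by rewrite lead_scale /c divfK // lead_eq0.
  have [R [Rds Rw ->]] := evalP N M ds _ (locus_neq0 Yw) (Y_ds _ Yw).
  have [[d hR] _] := dsg R Rds.
  have RE := zmap_scale c w hR.
  have [|b Rb] := ds_cs Q Qcs R Rds x Xx Qx.
    by move: Rw; rewrite RE scaler_eq0 => /norP[].
  have {RE}Rb : zmap R (c *: w) = (c ^+ d * b) *: x by rewrite RE -/w Rb scalerA.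
  rewrite Rb scaler_eq0 in Rw; have /norP[e0 _] := Rw.
  rewrite cw Rb lead_scale scalerA -[RHS]scale1r; congr (_ *: _).
  by rewrite mulrAC mulrC [lead x * _]mulrC mulVf // mulf_neq0 // lead_eq0.
rewrite -(card_in_imset (can_in_inj FK)); apply/subset_leq_card/fintype.subsetP => y.
by case/imsetP => x Xx ->; apply: FP.
Qed.

Lemma point_count_iso N M (X : locally_closed N) (Y : locally_closed M) :
  isomorphic X Y -> almost_all_primes (fun p => point_count X p = point_count Y p).
Proof.
case=> f [g [f_reg g_reg gf fg]].
have XY := cone_le f_reg g_reg gf; have YX := cone_le g_reg f_reg fg.
apply: aap_mono (aap_and XY YX) => p _ [le_XY le_YX].
by congr (- _%:R); apply/eqP; rewrite eqn_leq le_XY.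
Qed.

(** * Products *)

Section Product.
Variables (N M : nat) (X : locally_closed N) (Y : locally_closed M).
Variables (Z : locally_closed (N * M)) (Z_prod : is_product Z X Y).

Let segre : {ffun 'I_(N * M) -> {mpoly int[N + M]}} :=
  [ffun k => mxvec (\matrix_(i < N, j < M) ('X_(lshift M i) * 'X_(rshift N j))) 0 k].
Let left_coords : {ffun 'I_N -> {mpoly int[N + M]}} := [ffun i => 'X_(lshift M i)].
Let right_coords : {ffun 'I_M -> {mpoly int[N + M]}} := [ffun j => 'X_(rshift N j)].

Let zmap_left (F : fieldType) (x : 'rV[F]_N) (y : 'rV[F]_M) :
  zmap left_coords (row_mx x y) = x.
Proof. by apply/rowP => i; rewrite mxE ffunE zevalX row_mxEl. Qed.

Let zmap_right (F : fieldType) (x : 'rV[F]_N) (y : 'rV[F]_M) :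
  zmap right_coords (row_mx x y) = y.
Proof. by apply/rowP => i; rewrite mxE ffunE zevalX row_mxEr. Qed.

Let zmap_segre (F : fieldType) (x : 'rV[F]_N) (y : 'rV[F]_M) :
  zmap segre (row_mx x y) = mxvec (x^T *m y).
Proof.
apply/rowP => k; rewrite mxE ffunE; case/mxvec_indexP: k => i j.
rewrite !mxvecE !mxE big_ord1 rmorphM !zevalX row_mxEl row_mxEr.
by rewrite mxE.
Qed.

Lemma aap_segre : almost_all_primes (fun p => forall x y,
  x \in cone X p -> y \in cone Y p -> mxvec (x^T *m y) \in cone Z p).
Proof.
pose phi v := locus X (v \o subst left_coords) ==>
  (locus Y (v \o subst right_coords) ==> locus Z (v \o subst segre)).
have fin : finitary phi.
  apply: finitary_imply; first exact/finitary_comp/finitary_locus.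
  by apply: finitary_imply; apply/finitary_comp/finitary_locus.
have phiE (F : fieldType) (x : 'rV[F]_N) (y : 'rV[F]_M) :
    phi (vanish (row_mx x y)) = (locus X (vanish x) ==>
      (locus Y (vanish y) ==> locus Z (vanish (mxvec (x^T *m y))))).
  rewrite /phi -(eq_locus X (vanish_subst left_coords _)).
  rewrite -(eq_locus Y (vanish_subst right_coords _)).
  rewrite -(eq_locus Z (vanish_subst segre _)).
  by rewrite zmap_left zmap_right zmap_segre.
apply: aap_mono (transfer fin _) => [p _ h x y|u].
  by rewrite !inE => Xx Yy; have := h (row_mx x y); rewrite phiE Xx Yy.
rewrite -[u]hsubmxK phiE; apply/implyP => /locusP Xx; apply/implyP => /locusP Yy.
by apply/locusP/Z_prod; exists (lsubmx u), (rsubmx u).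
Qed.

Let row_coords i : {ffun 'I_M -> {mpoly int[N * M]}} :=
  [ffun j => 'X_(mxvec_index i j)].
Let col_coords j : {ffun 'I_N -> {mpoly int[N * M]}} :=
  [ffun i => 'X_(mxvec_index i j)].

(** At a nonzero entry the two factors can be read off, up to scalars, as a row and a column, and
    the minors through that entry say that they rebuild the matrix. *)
Lemma aap_segre_inv i j : almost_all_primes (fun p => forall A : 'M['F_p]_(N, M),
  mxvec A \in cone Z p -> A i j != 0 ->
  [/\ row i A \in cone Y p, (col j A)^T \in cone X p
    & forall k l, A i j * A k l = A i l * A k j]).
Proof.
pose x_ k l : {mpoly int[N * M]} := 'X_(mxvec_index k l).
pose minor k l := x_ i j * x_ k l - x_ i l * x_ k j.
pose phi v := locus Z v ==> (~~ v (x_ i j) ==>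
  [&& locus Y (v \o subst (row_coords i)), locus X (v \o subst (col_coords j))
    & all (fun k => all (fun l => v (minor k l)) (enum 'I_M)) (enum 'I_N)]).
have fin : finitary phi.
  apply: finitary_imply; first exact/finitary_locus.
  apply: finitary_imply; first exact/finitary_neg/finitary_atom.
  apply: finitary_and; first exact/finitary_comp/finitary_locus.
  apply: finitary_and; first exact/finitary_comp/finitary_locus.
  by apply: finitary_all => k; apply: finitary_all => l; apply: finitary_atom.
have x_E (F : fieldType) (A : 'M[F]_(N, M)) k l : zeval (mxvec A) (x_ k l) = A k l.
  by rewrite zevalX mxvecE.
have phiE (F : fieldType) (A : 'M[F]_(N, M)) :
    phi (vanish (mxvec A)) = (locus Z (vanish (mxvec A)) ==> ((A i j != 0) ==>
      [&& locus Y (vanish (row i A)), locus X (vanish (col j A)^T)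
        & [forall k, forall l, A i j * A k l == A i l * A k j]])).
  rewrite /phi [in ~~ _]/vanish x_E.
  rewrite -(eq_locus Y (vanish_subst (row_coords i) _)).
  rewrite -(eq_locus X (vanish_subst (col_coords j) _)).
  have -> : zmap (row_coords i) (mxvec A) = row i A.
    by apply/rowP => l; rewrite !mxE ffunE x_E.
  have -> : zmap (col_coords j) (mxvec A) = (col j A)^T.
    by apply/rowP => k; rewrite !mxE ffunE x_E.
  congr (_ ==> (_ ==> [&& _, _ & _])).
  have minorE k l : vanish (mxvec A) (minor k l) = (A i j * A k l == A i l * A k j).
    by rewrite /vanish /minor rmorphB !rmorphM !x_E subr_eq0.
  apply/allP/forallP => [h k|h k _].
    apply/forallP => l; rewrite -minorE.
    by apply: (allP (h k _)); rewrite mem_enum.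
  by apply/allP => l _; rewrite minorE; apply: (forallP (h k)).
apply: aap_mono (transfer fin _) => [p _ h A|z].
  rewrite !inE => ZA Aij; have := h (mxvec A); rewrite phiE ZA Aij.
  case/and3P => YA XA /forallP minA; split=> // k l.
  by apply/eqP; apply: (forallP (minA k)).
rewrite -[z]vec_mxK phiE; apply/implyP => /locusP/Z_prod[x [y [Xx Yy]]].
move/(can_inj mxvecK)=> ->.
have E k l : (x^T *m y) k l = x 0 k * y 0 l by rewrite !mxE big_ord1 mxE.
rewrite E mulf_eq0; apply/implyP => /norP[xi yj].
have -> : row i (x^T *m y) = x 0 i *: y by apply/rowP => l; rewrite mxE E mxE.
have -> : (col j (x^T *m y))^T = y 0 j *: x.
  by apply/rowP => k; rewrite mxE mxE E mxE mulrC.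
rewrite !locus_scale //; apply/and3P; split; [exact/locusP..|].
by apply/forallP => k; apply/forallP => l; rewrite !E; apply/eqP; ring.
Qed.

(** The pairs (a x, a^-1 y) have the same Segre image. The [lead] of the first factor separates
    them, which gives a bijection onto [cone Z p] times the nonzero scalars. *)
Lemma cone_product :
  almost_all_primes (fun p => #|cone X p| * #|cone Y p| = #|cone Z p| * p.-1)%N.
Proof.
have inv : almost_all_primes (fun p => forall ij : 'I_N * 'I_M,
    ij \in enum predT -> forall A : 'M['F_p]_(N, M),
    mxvec A \in cone Z p -> A ij.1 ij.2 != 0 ->
    [/\ row ij.1 A \in cone Y p, (col ij.2 A)^T \in cone X p
      & forall k l, A ij.1 ij.2 * A k l = A ij.1 l * A k ij.2]).
  by apply: aap_all => ij _; apply: aap_segre_inv.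
apply: aap_mono (aap_and aap_segre inv) => p pp [{}inZ {}inv].
pose f (xy : 'rV['F_p]_N * 'rV['F_p]_M) := (mxvec (xy.1^T *m xy.2), lead xy.1).
have E (x : 'rV['F_p]_N) (y : 'rV['F_p]_M) k l : (x^T *m y) k l = x 0 k * y 0 l.
  by rewrite !mxE big_ord1 mxE.
have cone_neq0 n (W : locally_closed n) x : x \in cone W p -> x != 0.
  by rewrite inE => /locus_neq0.
have fI : {in setX (cone X p) (cone Y p) &, injective f}.
  move=> [x y] [x' y']; rewrite !in_setX => /andP[/= Xx Yy] /andP[Xx' Yy'].
  case=> /(can_inj mxvecK) xy lead_xx'.
  have /rV0Pn[j yj] := cone_neq0 _ _ _ Yy.
  have xE : x = (y' 0 j / y 0 j) *: x'.
    apply/rowP => k; apply: (mulIf yj); rewrite -E xy E mxE.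
    by rewrite mulrC mulrAC divfK.
  have lx' : lead x' != 0 by rewrite lead_eq0; apply: cone_neq0 Xx'.
  have {xE}xx' : x = x'.
    rewrite xE; move: lead_xx'; rewrite {1}xE lead_scale => e.
    by rewrite (mulIf lx' (etrans e (esym (mul1r _)))) scale1r.
  have /rV0Pn[k xk] := cone_neq0 _ _ _ Xx.
  congr (_, _) => //; apply/rowP => l; apply: (mulfI xk).
  by rewrite -E xy E xx'.
have fE : f @: setX (cone X p) (cone Y p) = setX (cone Z p) [set c | c != 0].
  apply/setP => -[z c]; rewrite !inE; apply/imsetP/andP => [[[x y]]|[Zz c0]].
    rewrite in_setX => /andP[/= Xx Yy] [-> ->]; split.
      by have := inZ _ _ Xx Yy; rewrite inE.
    by rewrite lead_eq0; apply: cone_neq0 Xx.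
  have /rV0Pn[k zk] := locus_neq0 Zz.
  case/mxvec_indexP: k zk => i j; rewrite -[z]vec_mxK mxvecE in Zz *.
  set A := vec_mx z in Zz *; clearbody A => Aij.
  have ij_in : (i, j) \in enum {: 'I_N * 'I_M} by rewrite mem_enum.
  have ZA : mxvec A \in cone Z p by rewrite inE.
  have [YA XA /= minA] := inv (i, j) ij_in A ZA Aij.
  set x := (col j A)^T in XA; set y := row i A in YA.
  have lx0 : lead x != 0 by rewrite lead_eq0; apply: cone_neq0 XA.
  have a0 : c / lead x != 0 by rewrite mulf_neq0 ?invr_eq0.
  have b0 : (c / lead x * A i j)^-1 != 0 by rewrite invr_eq0 mulf_neq0.
  (* The first factor gets [lead] c; the second compensates and divides by A i j, because column j
     times row i is A i j times A. *)
  exists ((c / lead x) *: x, (c / lead x * A i j)^-1 *: y).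
    by apply/setXP; split; rewrite cone_scale.
  congr (_, _); last by rewrite lead_scale divfK.
  congr mxvec; apply/matrixP => k l; rewrite E !mxE.
  by rewrite -[LHS](mulKf Aij) minA /=; field; rewrite Aij lx0 c0.
rewrite -cardsX -(card_in_imset fI) fE cardsX; congr (_ * _)%N.
by rewrite cardsE cardC1 card_Fp.
Qed.

Lemma point_count_product : almost_all_primes (fun p =>
  point_count X p * point_count Y p = point_count Z p).
Proof.
apply: aap_mono cone_product => p pp e.
rewrite /point_count mulrNN -natrM e natrM -[RHS]mulr1 mulNr -mulrN.
congr (_ * _); apply/eqP; rewrite -subr_eq0 opprK natr1.
by rewrite prednK ?prime_gt0 // pchar_Fp_0.
Qed.

End Product.

(** * Graph hypersurface complements *)

(** Names the degree, deg p + 1 for nonzero p, that Chevalley-Warning compares with the n + 1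
    homogeneous coordinates. *)
Lemma homogenize_dhomog n (p : {mpoly rat[n]}) :
  'X_ord0 * homogenize p \is (msize p).-homog.
Proof.
have [->|p0] := eqVneq p 0.
  by rewrite /homogenize msupp0 big_nil mulr0 dhomog0.
have -> : msize p = (1 + (msize p).-1)%N by rewrite add1n prednK // lt0n msize_poly_eq0.
apply: dhomogM; first by have := dhomogXn (@ord0 n) 1; rewrite expr1.
rewrite /homogenize big_seq; apply: rpred_sum => m mp; apply: rpredZ.
have le_m : (mdeg m <= (msize p).-1)%N.
  by have := msize_mdeg_lt mp; case: (msize p).
have := @dhomogM n.+1 rat mdeg ((msize p).-1 - mdeg m)%N
          ('X_ord0 ^+ ((msize p).-1 - mdeg m)) (mdeg m).
rewrite /= subnK //; apply; first exact: dhomogXn.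
rewrite mdegE.
elim/big_ind2: _ => [|d q e r dq er|i _]; first exact: dhomog1.
  exact: dhomogM.
exact: dhomogXn.
Qed.

Lemma pevalM n (p q : {mpoly rat[n]}) y : peval (p * q) y = peval p y * peval q y.
Proof. by rewrite /peval rmorphM mevalM. Qed.

Lemma peval_prodX n (y : 'rV[algC]_n) :
  (peval (\prod_i 'X_i) y == 0) = vanish y (\prod_i 'X_i).
Proof.
rewrite /vanish rmorph_prod /peval !rmorph_prod; congr (_ == 0).
by apply: eq_bigr => i _; rewrite zevalX; apply: pevalX.
Qed.

Lemma locus_affine_complement n (p : {mpoly rat[n]}) (y : 'rV[algC]_n.+1) :
  locus (projT2 (affine_complement p)) (vanish y)
    = (peval ('X_ord0 * homogenize p) y != 0).
Proof.
rewrite locus_open //= pevalM pevalX.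
by apply: contra => /eqP ->; rewrite mxE mul0r.
Qed.

Lemma point_count_low_degree n (p : {mpoly rat[n]}) : (msize p <= n)%N ->
  almost_all_primes (fun l => point_count (projT2 (affine_complement p)) l = 0).
Proof.
move=> le_pn; have [D D0 fE] := zpolyP ('X_ord0 * homogenize p).
set f := zpoly _ in fE.
have hf := homog_clear fE (homogenize_dhomog p).
have : forall y : 'rV[algC]_n.+1,
    locus (projT2 (affine_complement p)) (vanish y) = ~~ vanish y f.
  by move=> y; rewrite locus_affine_complement (vanish_clear D0 fE).
move/cone_nonvanish; apply: aap_mono => l pl e.
by rewrite /point_count e (card_nonvanish_low_degree pl hf) ?oppr0.
Qed.

Lemma homogenize_prodX n :
  'X_ord0 * homogenize (\prod_(i < n) 'X_i) = \prod_(i < n.+1) 'X_i.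
Proof.
rewrite big_ord_recl; congr (_ * _).
have -> : \prod_(i < n) 'X_i = 'X_[[multinom 1 | i < n]] :> {mpoly rat[n]}.
  by rewrite mpolyXE_id; apply: eq_bigr => i _; rewrite mnmE expr1.
rewrite /homogenize msuppX big_seq1 mcoeffX eqxx scale1r msizeX /= subnn.
by rewrite expr0 mul1r; apply: eq_bigr => i _; rewrite mnmE expr1.
Qed.

Lemma point_count_prodX n : almost_all_primes (fun l =>
  point_count (projT2 (affine_complement (\prod_(i < n) 'X_i))) l = (-1) ^+ n).
Proof.
have : forall y : 'rV[algC]_n.+1,
    locus (projT2 (affine_complement (\prod_(i < n) 'X_i))) (vanish y)
      = ~~ vanish y (\prod_i 'X_i).
  by move=> y; rewrite locus_affine_complement homogenize_prodX peval_prodX.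
move/cone_nonvanish; apply: aap_mono => l pl e.
by rewrite /point_count e card_nonvanish_prodX // exprS mulN1r opprK.
Qed.

(** [msize] is the degree plus one on nonzero polynomials: degree below a times degree at most b
    gives degree below a + b, so one strict factor makes the product strict. *)
Lemma msizeM_low n (p q : {mpoly rat[n]}) a b :
  (msize p <= a)%N -> (msize q <= b.+1)%N -> (msize (p * q) <= a + b)%N.
Proof.
move=> pa qb; have [->|p0] := eqVneq p 0; first by rewrite mul0r msize0.
have [->|q0] := eqVneq q 0; first by rewrite mulr0 msize0.
by rewrite msizeM // -subn1 leq_subLR add1n -addnS leq_add.
Qed.

Lemma msize_prodX n (A : {set 'I_n}) :
  (msize (\prod_(e in A) 'X_e : {mpoly rat[n]}) <= #|A|.+1)%N.
Proof.
rewrite -sum1_card; elim/big_ind2: _ => [|p a q b pa qb|e _].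
- by rewrite msize1.
- by rewrite -addSn; apply: msizeM_low.
by rewrite msizeX mdeg1.
Qed.

Section GraphPolynomialDegree.
Variable G : graph.
Local Notation n := (nedges G).

Lemma adj_sym (T : {set 'I_n}) : ssrbool.symmetric (adj T).
Proof.
by move=> u v; apply: eq_existsb => e; rewrite /joins [in RHS]orbC.
Qed.

Definition edge_component (e : 'I_n) : {set vertex G} :=
  [set w | connect (adj setT) (ends e).1 w].

Lemma edge_component_in e : edge_component e \in components G.
Proof. exact: imset_f. Qed.

Lemma edges_ofE C e : C \in components G ->
  (e \in edges_of C) = (edge_component e == C).
Proof.
case/imsetP=> v _ ->; rewrite inE.
have csym := sym_connect_sym (adj_sym setT).
rewrite !inE; apply/idP/eqP => [ve|eC].
  by apply/setP => w; rewrite !inE -(same_connect csym ve).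
have : (ends e).1 \in edge_component e by rewrite inE connect0.
by rewrite eC inE.
Qed.

Lemma ends_component C e : C \in components G -> e \in edges_of C ->
  (ends e).1 \in C /\ (ends e).2 \in C.
Proof.
case/imsetP=> v _ ->; rewrite !inE => ve; split=> //.
apply: connect_trans ve (connect1 _); apply/existsP; exists e.
by rewrite inE /joins -surjective_pairing eqxx.
Qed.

(* If the empty set of edges connects [C], all edges of [C] are loops. *)
Lemma spanning_tree0 C (T : {set 'I_n}) : C \in components G ->
  spanning_tree C set0 -> spanning_tree C T -> T = set0.
Proof.
move=> CG [_ conn0 _] [subT _ acT]; apply/eqP/set0Pn => -[e eT].
have [e1 e2] := ends_component CG (fintype.subsetP subT e eT).
have /connectP[[|x s] /=] := conn0 _ _ e1 e2; last first.
  by case/andP=> /existsP[i]; rewrite inE.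
(* The path without edges is trivial, so e is a loop, and a loop is a cycle of length one. *)
move=> _ loop; apply: (acT [:: ((ends e).1, e)]).
  rewrite /is_cycle /= andbT /joins {1}[ends e]surjective_pairing loop.
  by rewrite eqxx.
by move=> i; rewrite inE => /eqP ->.
Qed.

(** If the empty set is a spanning tree it is the only one, and its monomial contains every edge;
    otherwise each tree has an edge, which its monomial omits. *)
Lemma component_polynomial_cases C : C \in components G ->
  (msize (component_polynomial C) <= #|edges_of C|)%N \/
  component_polynomial C = \prod_(e in edges_of C) 'X_e.
Proof.
move=> CG; have [sp0|sp0] := pselect (spanning_tree C set0).
  right; rewrite /component_polynomial (bigD1 set0) /=; last exact/asboolP.
  rewrite setD0 [X in _ + X]big1 ?addr0 // => T /andP[/asboolP spT /negP[]].
  by apply/eqP; apply: spanning_tree0 CG sp0 spT.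
left; apply: leq_trans (msize_sum _ _ _) _.
apply/bigmax_leqP => T /asboolP spT.
apply: leq_trans (msize_prodX _) _; rewrite -(cardsID T (edges_of C)) addnC.
rewrite -addn1 leq_add2l card_gt0; have [subT _ _] := spT.
by rewrite (setIidPr subT); apply/eqP => T0; apply: sp0; rewrite -T0.
Qed.

(** The components partition the edges, so the degree bounds add up to n, and a single component of
    low degree lowers the whole product. *)
Lemma graph_polynomial_cases :
  (msize (graph_polynomial G) <= n)%N \/ graph_polynomial G = \prod_i 'X_i.
Proof.
have partE (R : Type) (idx : R) (op : Monoid.com_law idx) (F : 'I_n -> R) :
    \big[op/idx]_e F e
      = \big[op/idx]_(C in components G) \big[op/idx]_(e in edges_of C) F e.
  rewrite (partition_big edge_component (mem (components G))) /=.
    by apply: eq_bigr => C CG; apply: eq_bigl => e; rewrite edges_ofE.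
  by move=> e _; apply: edge_component_in.
have nE : n = (\sum_(C in components G) #|edges_of C|)%N.
  rewrite -[LHS]card_ord -sum1_card partE; apply: eq_bigr => C _.
  by rewrite sum1_card.
have le_comp C : C \in components G ->
    (msize (component_polynomial C) <= #|edges_of C|.+1)%N.
  case/component_polynomial_cases=> [/leqW //|->]; exact: msize_prodX.
have [low|high] := pselect (exists2 C, C \in components G &
    (msize (component_polynomial C) <= #|edges_of C|)%N); last first.
  right; rewrite /graph_polynomial partE; apply: eq_bigr => C CG.
  by have [le_C|//] := component_polynomial_cases CG; case: high; exists C.
left; have [C CG le_C] := low.
rewrite [X in (_ <= X)%N]nE /graph_polynomial (bigD1 C) //= [X in (_ <= X)%N](bigD1 C) //=.
apply: msizeM_low => //.
elim/big_ind2: _ => [|p a q b pa qb|D /andP[DG _]]; first by rewrite msize1.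
  by rewrite -addSn; apply: msizeM_low.
exact: le_comp.
Qed.

Lemma point_count_graph : exists c : int, almost_all_primes (fun p =>
  point_count (projT2 (graph_complement G)) p = c%:~R).
Proof.
rewrite /graph_complement; have [le_n|->] := graph_polynomial_cases.
  by exists 0; exact: point_count_low_degree.
exists ((-1) ^+ n); apply: aap_mono (point_count_prodX n) => p _ ->.
by rewrite rmorphXn rmorphN1.
Qed.

End GraphPolynomialDegree.

(** * The variety of square roots of -1 *)

Lemma sum_sqr_homog : ('X_0 ^+ 2 + 'X_1 ^+ 2 : {mpoly rat[2]}) \is homog mdeg.
Proof. by apply/homogP; exists 2%N; apply: rpredD; apply: dhomogXn. Qed.

(** Spec Q(i), as the points [1 : i] and [1 : -i] of P^1. *)
Definition sqrtN1 : locally_closed 2 :=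
  ([:: exist _ ('X_0 ^+ 2 + 'X_1 ^+ 2) sum_sqr_homog], [:: exist _ 'X_ord0 (homogX0 1)]).

Lemma cone_sqrtN1 : almost_all_primes (fun p =>
  cone sqrtN1 p = [set x : 'rV_2 | (x 0 0 ^+ 2 + x 0 1 ^+ 2 == 0) && (x 0 0 != 0)]).
Proof.
pose f : {mpoly int[2]} := 'X_0 ^+ 2 + 'X_1 ^+ 2.
have fE (F : fieldType) (x : 'rV[F]_2) :
    vanish x f = (x 0 0 ^+ 2 + x 0 1 ^+ 2 == 0).
  by rewrite /vanish /f rmorphD !rmorphXn !zevalX.
have fin : finitary (fun v => locus sqrtN1 v == v f && ~~ v 'X_0).
  apply: finitary_eqb; first exact: finitary_locus.
  apply: finitary_and; first exact: finitary_atom.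
  exact/finitary_neg/finitary_atom.
apply: aap_mono (transfer fin _) => [p _ h|y].
  by apply/setP => x; rewrite !inE -fE -vanishX; apply/eqP/h.
rewrite /locus has_coord /= !vanish_zpoly fE vanishX /= pevalX andbT orbF.
have -> : peval ('X_0 ^+ 2 + 'X_1 ^+ 2) y = y 0 0 ^+ 2 + y 0 1 ^+ 2.
  by rewrite /peval rmorphD mevalD !rmorphXn /= !map_mpolyX !mevalXU.
apply/eqP; have [y0|y0] := eqVneq (y 0 0) 0; first by rewrite !andbF.
have -> // : y != 0 by apply: contra y0 => /eqP ->; rewrite mxE.
Qed.

Lemma point_count_no_sqrtN1 p : prime p ->
  cone sqrtN1 p = [set x : 'rV_2 | (x 0 0 ^+ 2 + x 0 1 ^+ 2 == 0) && (x 0 0 != 0)] ->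
  (forall s : 'F_p, s ^+ 2 != -1) -> point_count sqrtN1 p = 0.
Proof.
move=> pp e no_s; rewrite /point_count e (_ : [set x | _] = set0) ?cards0 ?oppr0 //.
apply/setP => x; rewrite !inE; apply/andP => -[/eqP sum0 x0].
have /eqP[] := no_s (x 0 1 / x 0 0).
rewrite expr_div_n; apply: (mulIf (expf_neq0 2 x0)).
by rewrite divfK ?expf_neq0 // mulN1r; apply/eqP; rewrite -addr_eq0 addrC sum0.
Qed.

Lemma Fp_N1_neq1 p : prime p -> (2 < p)%N -> (-1 == 1 :> 'F_p) = false.
Proof.
move=> pp lt_2p; rewrite eq_sym -addr_eq0; apply/negP/negP.
exact: (@intr_Fp_neq0 2).
Qed.

Lemma point_count_sqrtN1 p (s : 'F_p) : prime p -> (2 < p)%N ->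
  cone sqrtN1 p = [set x : 'rV_2 | (x 0 0 ^+ 2 + x 0 1 ^+ 2 == 0) && (x 0 0 != 0)] ->
  s ^+ 2 = -1 -> point_count sqrtN1 p = 2.
Proof.
move=> pp lt_2p e sE.
(* The representatives of [1 : s] and [1 : -s]: the cone has 2 (p - 1) elements, which is -2 modulo
   p. *)
pose f (ab : 'F_p * bool) : 'rV['F_p]_2 :=
  \row_j if j == 0 then ab.1 else (-1) ^+ ab.2 * s * ab.1.
have f0 ab : f ab 0 0 = ab.1 by rewrite mxE.
have f1 ab : f ab 0 1 = (-1) ^+ ab.2 * s * ab.1 by rewrite mxE.
have N1_neq1 : (-1 == 1 :> 'F_p) = false by apply: Fp_N1_neq1.
have s0 : s != 0.
  by apply: contra_eq_neq sE => ->; rewrite expr0n eq_sym oppr_eq0 oner_eq0.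
have fI : {in setX [set a | a != 0] setT &, injective f}.
  move=> [a b] [a' b']; rewrite !in_setX !inE !andbT /= => a0 _ /rowP e_f.
  have := e_f 0; rewrite !f0 /= => aa'; congr (_, _) => //.
  have := e_f 1; rewrite !f1 /= aa' in a0 *.
  move/(mulIf a0)/(mulIf s0); case: b {e_f}; case: b' => //= /eqP.
    by rewrite N1_neq1.
  by rewrite eq_sym N1_neq1.
have fE : cone sqrtN1 p = f @: setX [set a | a != 0] setT.
  rewrite e; apply/setP => x; rewrite inE; apply/andP/imsetP => [[/eqP sum0 x0]|].
    have : (x 0 1 - s * x 0 0) * (x 0 1 + s * x 0 0) = 0.
      by rewrite -subr_sqr exprMn sE mulN1r opprK addrC.
    have xf (b : bool) : x 0 1 = (-1) ^+ b * s * x 0 0 -> x = f (x 0 0, b).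
      move=> x1; apply/rowP => j; case: (unliftP 0 j) => [k|] ->; last by rewrite f0.
      have -> : lift 0 k = 1 by rewrite ord1; apply: val_inj.
      by rewrite f1 x1.
    move/eqP; rewrite mulf_eq0 subr_eq0 addr_eq0 => /orP[] /eqP x1.
      by exists (x 0 0, false); rewrite ?in_setX ?inE ?x0 //; apply: xf; rewrite mul1r.
    by exists (x 0 0, true); rewrite ?in_setX ?inE ?x0 //; apply: xf; rewrite x1 mulN1r mulNr.
  case=> -[a b]; rewrite in_setX inE => /andP[/= a0 _] ->; rewrite f0 f1 /= a0.
  by rewrite !exprMn sE sqrr_sign mul1r mulN1r subrr.
rewrite /point_count fE card_in_imset // cardsX cardsT card_bool.
rewrite (_ : #|[set a : 'F_p | a != 0]| = p.-1); last first.
  by rewrite cardsE cardC1 card_Fp.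
rewrite natrM -mulNr -[RHS]mul1r; congr (_ * _); apply/eqP.
by rewrite eq_sym -addr_eq0 nat1r prednK ?prime_gt0 // pchar_Fp_0.
Qed.

(** * Large primes with and without a square root of -1 *)

Lemma infinitely_many_sqrtN1 k :
  exists p, [/\ prime p, (k <= p)%N, (2 < p)%N & exists s : 'F_p, s ^+ 2 = -1].
Proof.
(* As in Euclid's proof, p exceeds k + 2, where the 2 secures p > 2; and m is a square root of -1
   modulo p. *)
pose m := (k + 2)`!; pose p := pdiv (m ^ 2).+1.
have m0 : (0 < m)%N by apply: fact_gt0.
have pp : prime p by apply: pdiv_prime; rewrite ltnS expn_gt0 m0.
have lt_p : (k + 2 < p)%N.
  rewrite ltnNge; apply/negP => le_p.
  have dvd : (p %| m ^ 2)%N.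
    by apply: dvdn_exp => //; apply: dvdn_fact; rewrite prime_gt0.
  have := pdiv_dvd (m ^ 2).+1; rewrite -/p -addn1 (dvdn_addr _ dvd) dvdn1.
  by move/eqP => p1; rewrite p1 in pp.
exists p; split=> //; [lia..|].
exists m%:R; apply/eqP; rewrite -addr_eq0 -natrX natr1.
by rewrite -(dvdn_pcharf (pchar_Fp pp)) pdiv_dvd.
Qed.

Lemma prime_divisor_3mod4 (n : nat) : (n %% 4)%N = 3%N ->
  exists p, [/\ prime p, (p %| n)%N & (p %% 4)%N = 3%N].
Proof.
elim/ltn_ind: n => n IHn n3.
have n1 : (1 < n)%N by move: n3; case: n {IHn} => [|[|]].
have pp := pdiv_prime n1; have pn := pdiv_dvd n; set p := pdiv n in pp pn.
have [p3|p3] := eqVneq (p %% 4)%N 3%N; first by exists p.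
have nE : n = (n %/ p * p)%N by rewrite divnK.
(* Modulo 4, 3 is a product only as 1 * 3, so removing a prime not congruent to 3 leaves a cofactor
   congruent to 3. *)
have q3 : (n %/ p %% 4)%N = 3%N.
  have := modnMm (n %/ p) p 4; rewrite -nE n3.
  have := ltn_pmod (n %/ p) (isT : 0 < 4)%N; have := ltn_pmod p (isT : 0 < 4)%N.
  move: (n %/ p %% 4)%N (p %% 4)%N p3.
  by case=> [|[|[|[|?]]]] // [|[|[|[|?]]]].
have [|r [pr rq r3]] := IHn (n %/ p)%N _ q3.
  by rewrite ltn_Pdiv ?prime_gt1 // ltnW.
by exists r; split=> //; rewrite nE dvdn_mulr.
Qed.

Lemma infinitely_many_no_sqrtN1 k :
  exists p, [/\ prime p, (k <= p)%N & forall s : 'F_p, s ^+ 2 != -1].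
Proof.
have [|p [pp pn p3]] := @prime_divisor_3mod4 (4 * k`!).-1.
  have := fact_gt0 k; move: (k`!) => m m0; lia.
exists p; split=> //.
  rewrite leqNgt; apply/negP => lt_pk.
  have : (p %| 4 * k`!)%N by rewrite dvdn_mull // dvdn_fact // prime_gt0 // ltnW.
  rewrite -[(4 * _)%N]prednK ?muln_gt0 ?fact_gt0 // -addn1 dvdn_addr // dvdn1.
  by move/eqP => p1; rewrite p1 in pp.
move=> s; apply/eqP => sE.
have s0 : s != 0.
  by apply: contra_eq_neq sE => ->; rewrite expr0n eq_sym oppr_eq0 oner_eq0.
have := Fp_expr_predp s pp; rewrite s0.
(* (p - 1) / 2 is odd, so a square root s of -1 would satisfy s^(p-1) = -1, against Fermat. *)
have -> : p.-1 = (2 * (p %/ 4 * 2 + 1))%N.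
  by rewrite {1}(divn_eq p 4) p3; lia.
rewrite exprM sE exprD mulnC exprM sqrrN !expr1n mul1r expr1 => /eqP.
rewrite Fp_N1_neq1 //; have := prime_gt1 pp; move: p3.
by case: (p) => [|[|[|]]].
Qed.

(** * The point count on the Grothendieck ring *)

Import -(notations) finmap monalg.

Section MonomialEval.
Variables (I : choiceType) (R : comNzRingType) (w : I -> R).
Implicit Types m : monalg.cmonom I.

Definition monomial_eval m : R := \prod_(X <- finmap.finsupp m) w X ^+ m X.

Lemma monomial_evalEw m (d : finmap.finset_of (Phant I)) :
  finmap.fsubset (finmap.finsupp m) d -> monomial_eval m = \prod_(X <- d) w X ^+ m X.
Proof.
move=> le; rewrite /monomial_eval (finmap.big_fset_incl _ le) // => X _.
by rewrite -monalg.cmE_eq0 => /eqP ->; rewrite expr0.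
Qed.

Fact monomial_eval_morphism : monalg.mmorphism monomial_eval.
Proof.
split=> [m1 m2|]; last first.
  by rewrite /monomial_eval monalg.mdom1 finmap.big_seq_fset0.
rewrite {1}/monomial_eval monalg.mdomD.
rewrite (monomial_evalEw (finmap.fsubsetUl _ (finmap.finsupp m2))).
rewrite (monomial_evalEw (finmap.fsubsetUr (finmap.finsupp m1) _)).
by rewrite -big_split /=; apply: eq_bigr => X _; rewrite monalg.cmM exprD.
Qed.
HB.instance Definition _ :=
  monalg.isMultiplicative.Build _ _ monomial_eval monomial_eval_morphism.

End MonomialEval.

Lemma count_exists p : exists f : {rmorphism free_ring -> 'F_p},
  forall N (X : locally_closed N), f (symbol_in X) = point_count X p.
Proof.
pose weight (X : variety) : 'F_p := point_count (projT2 X) p.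
exists (monalg.mmap intr (monomial_eval weight)) => N X.
rewrite /= /symbol_in monalg.mmapU /= mulr1z mul1r /monomial_eval monalg.mdomU.
by rewrite finmap.big_seq_fset1 monalg.cmUU expr1.
Qed.

Definition count p : {rmorphism free_ring -> 'F_p} := sval (cid (count_exists p)).

Lemma count_symbol_in p N (X : locally_closed N) :
  count p (symbol_in X) = point_count X p.
Proof. exact: svalP (cid (count_exists p)) N X. Qed.

Lemma count_symbol p X : count p (symbol X) = point_count (projT2 X) p.
Proof. by case: X => N X; apply: count_symbol_in. Qed.

Lemma count_relation r : K_relation r -> almost_all_primes (fun p => count p r = 0).
Proof.
case=> [N M X Y XY|N X Y U YX UXY|N M X Y Z ZXY|].
- apply: aap_mono (point_count_iso XY) => p _ e.
  rewrite rmorphB; apply/eqP; rewrite subr_eq0; apply/eqP.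
  exact: etrans (count_symbol_in p X) (etrans e (esym (count_symbol_in p Y))).
- apply: aap_mono (point_count_scissor YX UXY) => p _ e.
  rewrite rmorphB rmorphD; apply/eqP; rewrite subr_eq0; apply/eqP.
  apply: etrans (count_symbol_in p X) (etrans e _).
  by congr (_ + _); apply/esym/count_symbol_in.
- apply: aap_mono (point_count_product ZXY) => p _ e.
  rewrite rmorphB rmorphM; apply/eqP; rewrite subr_eq0; apply/eqP.
  apply: etrans (etrans e (esym (count_symbol_in p Z))).
  by congr (_ * _); apply: count_symbol_in.
apply: aap_mono point_count_point => p _ e.
rewrite rmorphB; apply/eqP; rewrite subr_eq0; apply/eqP.
exact: etrans (count_symbol p _) (etrans e (esym (rmorph1 _))).
Qed.

(** A member of the ideal involves finitely many relations, so their bounds on p have a maximum. *)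
Lemma count_ideal x :
  ideal_gen K_relation x -> almost_all_primes (fun p => count p x = 0).
Proof.
elim=> [|a r y Kr _ IHy]; first by apply: aap_true => p _; apply: rmorph0.
apply: aap_mono (aap_and (count_relation Kr) IHy) => p _ [r0 y0].
by rewrite rmorphD rmorphM r0 y0 mulr0 addr0.
Qed.

Lemma count_eq x y : quotient_class K_relation x = quotient_class K_relation y ->
  almost_all_primes (fun p => count p x = count p y).
Proof.
move/eqP/quotient_classP/count_ideal; apply: aap_mono => p _.
by rewrite rmorphB => /eqP; rewrite subr_eq0 => /eqP.
Qed.

(** * Counts equal to a fixed integer, and localization *)

Definition Z_L_poly (q : {poly int}) : free_ring :=
  (map_poly intr q).[symbol (affine_space 1)].

Definition constant_count x (c : int) : Prop :=
  almost_all_primes (fun p => count p x = c%:~R).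

Lemma constant_countD x y c d :
  constant_count x c -> constant_count y d -> constant_count (x + y) (c + d).
Proof.
move=> xc yd; apply: aap_mono (aap_and xc yd) => p _ [xp yp].
by rewrite rmorphD xp yp rmorphD.
Qed.

Lemma constant_countM x y c d :
  constant_count x c -> constant_count y d -> constant_count (x * y) (c * d).
Proof.
move=> xc yd; apply: aap_mono (aap_and xc yd) => p _ [xp yp].
by rewrite rmorphM xp yp rmorphM.
Qed.

Lemma constant_count_Z_L q : constant_count (Z_L_poly q) q.[0].
Proof.
apply: aap_mono point_count_line => p _ L0.
rewrite /Z_L_poly -horner_map /= count_symbol L0 -map_poly_comp.
by rewrite !horner_coef0 coef_map /= rmorph_int.
Qed.

Lemma scale_class q x : q *: (quotient_class K_relation x : KVar)
  = quotient_class K_relation (Z_L_poly q * x).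
Proof. exact/esym/quotient_classM. Qed.

Lemma frac_class_eq x y (s t : denominator S') :
  @Defs.frac _ S' KVar (quotient_class K_relation x) s
    = @Defs.frac _ S' KVar (quotient_class K_relation y) t ->
  exists2 u, S' u &
    quotient_class K_relation (Z_L_poly u * (Z_L_poly (sval t) * x))
      = quotient_class K_relation (Z_L_poly u * (Z_L_poly (sval s) * y)).
Proof.
move=> /(proj1 (@Defs.fracP _ S' KVar _ _ s t))[u Su e].
exists u; first exact: Su.
have scale2 a z : u *: (a *: (quotient_class K_relation z : KVar))
    = quotient_class K_relation (Z_L_poly u * (Z_L_poly a * z)).
  apply: etrans (scale_class u (Z_L_poly a * z)).
  by apply: congr1; apply: scale_class.
exact: etrans (esym (scale2 _ x)) (etrans e (scale2 _ y)).
Qed.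

(** Evaluation at 0 sends L^n - 1 to -1, and divisors of units are units, so saturation keeps the
    values among 1 and -1. *)
Lemma S'_unit q : S' q -> q.[0] \is a GRing.unit.
Proof.
elim=> [_ [n n0 ->]||a b _ ha _ hb|a b _]; rewrite ?hornerE //.
- by rewrite expr0n gtn_eqF // sub0r unitrN1.
- by rewrite unitrM ha.
by rewrite unitrM => /andP[].
Qed.

(** Constancy is asked of the numerator of one representation, lifted to the free ring. This is
    stable under sums and scalars, and denominators are removed only in
    [almost_constant_point_count]. *)
Definition almost_constant (w : localization S' KVar) : Prop :=
  exists x s c, w = @Defs.frac _ S' KVar (quotient_class K_relation x) s /\
    constant_count x c.

Lemma almost_constantD w w' :
  almost_constant w -> almost_constant w' -> almost_constant (w + w').
Proof.
move=> [x [s [c [-> xc]]]] [y [t [d [-> yd]]]].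
exists (Z_L_poly (sval t) * x + Z_L_poly (sval s) * y), (denomM s t).
exists ((sval t).[0] * c + (sval s).[0] * d); split.
  rewrite fracD (scale_class (sval t) x) (scale_class (sval s) y).
  by rewrite -quotient_classD.
by apply: constant_countD; apply: constant_countM => //; apply: constant_count_Z_L.
Qed.

Lemma almost_constantZ (a : loc_ring S') w :
  almost_constant w -> almost_constant (a *: w).
Proof.
move=> [x [t [c [-> xc]]]]; elim/fracW: a => a s.
exists (Z_L_poly a * x), (denomM s t), (a.[0] * c); split.
  by rewrite -(scale_class a x); apply: loc_scaleE.
by apply: constant_countM => //; apply: constant_count_Z_L.
Qed.

Lemma almost_constant0 : almost_constant 0.
Proof.
exists 0, (denom1 S'), 0; split; first by rewrite rmorph0.
by apply: aap_true => p _; rewrite !rmorph0.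
Qed.

Lemma almost_constant_graph (G : graph) :
  almost_constant (loc_map S' (K_class (graph_complement G))).
Proof.
have [c Gc] := point_count_graph G.
exists (symbol (graph_complement G)), (denom1 S'), c; split=> //.
by apply: aap_mono Gc => p _; apply: etrans (count_symbol _ _).
Qed.

Lemma almost_constant_point_count N (X : locally_closed N) :
  almost_constant (loc_map S' (K_class (existT locally_closed N X))) ->
  exists c : int, almost_all_primes (fun p => point_count X p = c%:~R).
Proof.
move=> [x [s [c [/frac_class_eq[u Su /count_eq cnt] xc]]]].
have unit_u := S'_unit Su; have unit_s := S'_unit (asboolW (valP s)).
(* The count of u s is the integer [k], which is 1 or -1 and so its own inverse: multiplying by [k]
   removes u and s. *)
pose k := u.[0] * (sval s).[0].
have kk : k * k = 1.
  have : k \is a GRing.unit by rewrite unitrM unit_u.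
  by rewrite qualifE /= => /orP[] /eqP ->.
have y_count p := count_symbol_in p X; rewrite /symbol_in in y_count.
move: (symbol _) y_count cnt => y y_count cnt.
have ux := constant_countM (constant_count_Z_L u)
             (constant_countM (constant_count_Z_L (sval (denom1 S'))) xc).
have us := constant_countM (constant_count_Z_L u) (constant_count_Z_L (sval s)).
move: (Z_L_poly u) (Z_L_poly (sval s)) (Z_L_poly (sval (denom1 S'))) => a b d in ux us cnt.
exists (k * (u.[0] * ((sval (denom1 S')).[0] * c))).
apply: aap_mono (aap_and cnt (aap_and ux us)) => p _ [cp [uxp usp]].
rewrite -y_count rmorphM /= -uxp -cp mulrA rmorphM usp mulrA -rmorphM.
by rewrite kk mul1r.
Qed.

(** A prime p > |c| without a square root of -1 forces c = 0; a prime p > 2 with one would then give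
    2 = 0 modulo p. *)
Lemma sqrtN1_not_constant (c : int) :
  ~ almost_all_primes (fun p => point_count sqrtN1 p = c%:~R).
Proof.
move=> cP; have [k kP] := aap_and cP cone_sqrtN1.
have c0 : c = 0.
  have [p [pp le_p no_s]] := infinitely_many_no_sqrtN1 (k + `|c|.+1).
  have [|e1 e2] := kP p pp; first by lia.
  apply/eqP; apply: contrapT => /negP c0.
  have : c%:~R != 0 :> 'F_p by apply: intr_Fp_neq0 => //; lia.
  by rewrite -e1 (point_count_no_sqrtN1 pp e2 no_s) eqxx.
have [p [pp le_p lt_2p [s sE]]] := infinitely_many_sqrtN1 k.
have [e1 e2] := kP p pp le_p.
have := point_count_sqrtN1 pp lt_2p e2 sE; rewrite e1 c0 => /esym/eqP.
by apply/negP; apply: (@intr_Fp_neq0 2).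
Qed.

Theorem corollary3p7 :
  ~ @generates (loc_ring S') (localization S' KVar)
      (fun y => exists G : graph, y = loc_map S' (K_class (graph_complement G))).
Proof.
move=> /(_ (loc_map S' (K_class (existT locally_closed 2 sqrtN1)))) [s [s_graph e]].
have [c cP] : exists c : int, almost_all_primes (fun p => point_count sqrtN1 p = c%:~R).
  apply: almost_constant_point_count; rewrite e big_seq.
  elim/big_ind: _ => [||[a w] /s_graph [G /= ->]].
  - exact: almost_constant0.
  - exact: almost_constantD.
  exact/almost_constantZ/almost_constant_graph.
exact: sqrtN1_not_constant cP.
Qed.
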